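(* Let $c$ be the midpoint of $[a,b]$. Let $f:[a,b]\to\mathbb{R}$ be such that $f'$ is absolutely continuous and $f''\in L^p([a,b])$ for some $1<p<\infty$. Let $1/p+1/q=1$. Amongst all monic quadratic polynomials $\phi$ used to generate the formula $$\int_a^b f(x)\,dx=\tfrac12\left[-f(a)\phi'(a)+f(b)\phi'(b)+f'(a)\phi(a)-f'(b)\phi(b)\right]+E(f),\qquad(\ast)$$ taking $\phi(x)=(x-c)^2-\alpha_q^2$ gives the unique minimum for the error $|E(f)|$. The constant $\beta_q>1$ is the unique solution of the equation $$\int_1^{\beta_q}(x^2-1)^{q-1}\,dx=\tfrac12 B(q,1/2)=2^{2q-2}B(q,q)$$ and $\alpha_q\beta_q=(b-a)/2$. This gives the quadrature formula $$\int_a^b f(x)\,dx=\frac{b-a}{2}\left[f(a)+f(b)\right]+\frac{(b-a)^2}{8}\left(1-\beta_q^{-2}\right)\left[f'(a)-f'(b)\right]+E(f),$$ where $$|E(f)|\le\frac{\|f''\|_p\,(b-a)^{2+1/q}\left(1-\beta_q^{-2}\right)}{2^{3+1/q}(q+1/2)^{1/q}}.$$ The coefficient of $\|f''\|_p$ in the error bound is the best possible.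
   Context: $[a,b]$ is a compact real interval. $B(x,y)=\Gamma(x)\Gamma(y)/\Gamma(x+y)$ is the beta function. $\|\cdot\|_p$ is the $L^p([a,b])$ norm. Formula $(\ast)$ comes from integration by parts, with $\phi$ a monic quadratic polynomial with real coefficients and $E(f)=\tfrac12\int_a^b f''(x)\phi(x)\,dx$; so $E(f)$ depends on the choice of $\phi$, and in the final quadrature formula it is the error for $\phi(x)=(x-c)^2-\alpha_q^2$. *)

(* Defs.v *)
From HB Require Import structures.
From mathcomp Require Import all_boot all_order all_algebra.
From mathcomp Require Import all_classical all_reals all_analysis.

Set Implicit Arguments.
Unset Strict Implicit.
Unset Printing Implicit Defensive.

Import Order.TTheory GRing.Theory Num.Theory.
Import numFieldNormedType.Exports.

Local Open Scope classical_set_scope.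
Local Open Scope ring_scope.

Definition Gamma_fun (R : realType) (x : R) : R :=
  \int[lebesgue_measure]_(t in `]0, +oo[) (t `^ (x - 1) * expR (- t)).

(* The library's [beta_fun] only takes natural number arguments. *)
Definition Beta_fun (R : realType) (x y : R) : R :=
  Gamma_fun x * Gamma_fun y / Gamma_fun (x + y).

Section on_interval.
Context {R : realType}.
Variables a b : R.
Implicit Types f : R -> R.

(* The functions of interest live on [a, b], so difference quotients only use
   points of [a, b]: the derivative is one-sided at a and at b, and the values
   of f outside [a, b] are irrelevant. *)
Definition is_deriv_on f (x l : R) : Prop :=
  (f y - f x) / (y - x) @[y --> within `[a, b] (x^')] --> l.

Definition derivable_on f (x : R) : Prop := exists l : R, is_deriv_on f x l.

Definition deriv_on f (x : R) : R :=
  lim ((f y - f x) / (y - x) @[y --> within `[a, b] (x^')]).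

Definition abs_continuous_on f : Prop :=
  forall e : R, 0 < e -> exists2 d : R, 0 < d &
    forall (n : nat) (u v : 'I_n -> R),
      (forall i, [/\ a <= u i, u i <= v i & v i <= b]) ->
      trivIset [set: 'I_n] (fun i => `]u i, v i[%classic) ->
      \sum_(i < n) (v i - u i) < d ->
      \sum_(i < n) `|f (v i) - f (u i)| < e.

Definition LpNorm_on (p : R) f : \bar R :=
  ('N[lebesgue_measure]_(p%:E) [EFin \o (f \_ `[a, b])])%E.

Definition Lp_on (p : R) f : Prop :=
  f \_ `[a, b] \in Lfun lebesgue_measure p%:E.

(* [deriv_on (deriv_on f)] need only exist almost everywhere; where it does not,
   it takes an arbitrary default value, on a negligible set when f' is absolutely
   continuous. *)
Definition admissible (p : R) f : Prop :=
  [/\ (forall x, x \in `[a, b] -> derivable_on f x),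
      abs_continuous_on (deriv_on f)
    & Lp_on p (deriv_on (deriv_on f))].

Definition monic_quadratic (phi : {poly R}) : Prop :=
  phi \is monic /\ size phi = 3%N.

Definition quad_error (phi : {poly R}) f : R :=
  2^-1 * \int[lebesgue_measure]_(x in `[a, b])
           (deriv_on (deriv_on f) x * phi.[x]).

Definition quad_rule (phi : {poly R}) f : R :=
  2^-1 * (- f a * phi^`().[a] + f b * phi^`().[b]
          + deriv_on f a * phi.[a] - deriv_on f b * phi.[b]).

(* For one fixed f, |E(f)| can generally be made 0 by a suitable phi; the error
   of the formula generated by phi is its largest value over all admissible f
   with ||f''||_p <= 1, i.e. the best K in |E(f)| <= K ||f''||_p. *)
Definition worst_error (p : R) (phi : {poly R}) : \bar R :=
  ereal_sup [set (`|quad_error phi f|)%:E | f in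
    [set f | admissible p f /\ (LpNorm_on p (deriv_on (deriv_on f)) <= 1)%E]].

End on_interval.

(* Main.v *)
(* Integrating by parts twice gives the quadrature formula with
   E(f) = 1/2 int f'' phi; for the absolutely continuous f' this rests on the
   fact that an absolutely continuous function is the integral of its almost
   everywhere derivative, obtained here from Dini derivates. By Hoelder's
   inequality and its equality case f'' = const * sgn(phi) |phi|^(q-1), the worst
   error of the formula generated by phi is half the L^q norm of phi, so the best
   monic quadratic is the one of least L^q norm. Since |u|^q is strictly convex,
   phi0 is the unique minimizer as soon as S = sgn(phi0) |phi0|^(q-1) is orthogonal
   to the polynomials of degree at most one. Orthogonality to x - c holds by
   symmetry, and int S = 0 becomes, with x = c + alpha t, the equation
   int_1^beta (t^2 - 1)^(q-1) dt = int_0^1 (1 - t^2)^(q-1) dt, whose right-hand side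
   is the stated multiple of the beta function. *)
Require Import Defs.
From HB Require Import structures.
From mathcomp Require Import all_boot all_order all_algebra.
From mathcomp Require Import all_classical all_reals all_analysis.
From mathcomp Require Import measurable_realfun ring lra.

Set Implicit Arguments.
Unset Strict Implicit.
Unset Printing Implicit Defensive.

Import Order.TTheory GRing.Theory Num.Theory.
Import numFieldNormedType.Exports.

Local Open Scope classical_set_scope.
Local Open Scope ring_scope.

(** * One-sided derivatives *)

(** An admissible [f] has a second derivative only almost everywhere, so under the integral f'' is
    replaced by the upper right Dini derivate of f', which is measurable and whose integrability
    comes from the variation of f'. The product f' phi is again absolutely continuous; applying the
    same theorem to it does the work of the first integration by parts. The optimality claim
    compares suprema over [f]. A strict inequality of L^q norms gives a strict inequality of worst
    errors because every competitor phi has its own extremal function, so its supremum is attained.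
    The constant comes from integrating the derivative of (x - c) |phi0|^q: since int S = 0, what
    remains is (2 q + 1) int |phi0|^q = (b - a) phi0(b)^q, with phi0(b) = ((b - a) / 2)^2 (1 -
    beta^-2). As B is defined as a quotient of Gamma values, its two occurrences first need Euler's
    product formula, obtained by Tonelli; the two substitutions then reduce both to the same
    integral. *)

Section deriv_on_theory.
Context {R : realType}.
Variables a b : R.
Implicit Types (f g : R -> R) (x l : R).

(** Multiplying through by [y - x] removes the division and the puncture: the inequality is trivial
    at [y = x]. *)
Lemma is_deriv_onP f x l : is_deriv_on a b f x l <->
  forall e, 0 < e -> exists2 d, 0 < d & forall y, a <= y -> y <= b -> `|y - x| < d ->
    `|f y - f x - l * (y - x)| <= e * `|y - x|.
Proof.
split=> [/cvgrPdist_le H e e0|H].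
  have := H e e0; rewrite near_withinE => /= -[d /= d0 dP]; exists d => // y ay yb yxd.
  have [->|yx] := eqVneq y x; first by rewrite !subrr mulr0 subr0 normr0 mulr0.
  have yx0 : y - x != 0 by rewrite subr_eq0.
  have := dP y; rewrite /ball_/= distrC => /(_ yxd yx).
  rewrite in_itv/= ay yb => /(_ isT) le_e.
  have -> : f y - f x - l * (y - x) = - (l - (f y - f x) / (y - x)) * (y - x) by field.
  by rewrite normrM normrN ler_pM2r// normr_gt0.
apply/cvgrPdist_le => e e0; have [d d0 dP] := H e e0.
rewrite near_withinE; exists d => //= y; rewrite /ball_/= distrC => yxd yx.
rewrite in_itv/= => /andP[ay yb].
have yx0 : y - x != 0 by rewrite subr_eq0.
have := dP y ay yb yxd.
have -> : f y - f x - l * (y - x) = - (l - (f y - f x) / (y - x)) * (y - x) by field.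
by rewrite normrM normrN ler_pM2r// normr_gt0.
Qed.

Hypothesis ab : a < b.

(** This makes limits along the filter unique, so that [lim] in [deriv_on] returns the derivative
    whenever there is one. The witness is a half step to the left at [b] and to the right elsewhere,
    clipped to the segment. *)
Lemma within_segment_dnbhs_proper x : a <= x -> x <= b ->
  ProperFilter (within `[a, b] (x^')).
Proof.
move=> ax xb; split; last exact: within_filter.
move=> [d /= d0 dP].
have [bx|xb'] := leP b x.
  pose y := Num.max a (x - d / 2).
  have yx : y < x by rewrite gt_max (lt_le_trans ab bx) ltrBlDr ltrDl divr_gt0.
  apply: (dP y); rewrite /ball_/=.
  - rewrite gtr0_norm ?subr_gt0// ltrBlDr -ltrBlDl lt_max; apply/orP; right; lra.
  - by rewrite lt_eqF.
  - by rewrite in_itv/= le_max lexx (le_trans (ltW yx)).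
pose y := Num.min b (x + d / 2).
have yx : x < y by rewrite lt_min xb' ltrDl divr_gt0.
apply: (dP y); rewrite /ball_/=.
- rewrite distrC gtr0_norm ?subr_gt0// ltrBlDl gt_min; apply/orP; right; lra.
- by rewrite gt_eqF.
- by rewrite in_itv/= ge_min lexx (le_trans _ (ltW yx)).
Qed.

Lemma deriv_onE f x l : a <= x -> x <= b -> is_deriv_on a b f x l -> deriv_on a b f x = l.
Proof.
move=> ax xb fxl; have PF := within_segment_dnbhs_proper ax xb.
exact: (cvg_lim _ fxl).
Qed.

Lemma is_deriv_on_derive f x l : a < x -> x < b -> is_deriv_on a b f x l ->
  is_derive x 1 f l.
Proof.
move=> ax xb /is_deriv_onP H.
have : h^-1 *: (f (h *: 1 + x) - f x) @[h --> 0^'] --> l.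
  apply/cvgrPdist_le => e e0; have [d d0 dP] := H e e0.
  near=> h.
  have h0 : h != 0 by near: h; exact: nbhs_dnbhs_neq.
  have hm : `|h| < Num.min d (Num.min (x - a) (b - x)).
    near: h; apply: dnbhs0_lt; by rewrite !lt_min d0 !subr_gt0 ax xb.
  move: hm; rewrite !lt_min => /and3P[hd hxa hbx].
  have := dP (h + x); rewrite addrK => H'.
  have {}H' : `|f (h + x) - f x - l * h| <= e * `|h|.
    by apply: H' => //; move: hxa hbx; rewrite !ltr_norml => /andP[? ?] /andP[? ?]; lra.
  rewrite /GRing.scale/= mulr1 distrC.
  have -> : h^-1 * (f (h + x) - f x) - l = (f (h + x) - f x - l * h) / h by field.
  by rewrite normrM normfV ler_pdivrMr ?normr_gt0.
move=> H'; split; first by apply/cvg_ex; exists l.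
exact: cvg_lim H'.
Unshelve. all: by end_near. Qed.

Lemma derive_is_deriv_on f x l : is_derive x 1 f l -> is_deriv_on a b f x l.
Proof.
move=> fxl; apply/is_deriv_onP => e e0.
have /cvgrPdist_le/(_ e e0) : h^-1 *: (f (h *: 1 + x) - f x) @[h --> 0^'] --> l.
  by rewrite -(@derive_val _ _ _ _ _ _ _ fxl); apply: (@ex_derive _ _ _ _ _ _ _ fxl).
move=> /= [d /= d0 dP]; exists d => // y _ _ yxd.
have [->|yx] := eqVneq y x; first by rewrite !subrr mulr0 subr0 normr0 mulr0.
have := dP (y - x); rewrite /ball_/= sub0r normrN => /(_ yxd).
rewrite subr_eq0 => /(_ yx); rewrite scaler1 subrK => H.
have yx0 : 0 < `|y - x| by rewrite normr_gt0 subr_eq0.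
have -> : f y - f x - l * (y - x) = - (l - (y - x)^-1 *: (f y - f x)) * (y - x).
  by rewrite /GRing.scale/=; field; rewrite subr_eq0.
by rewrite normrM normrN ler_pM2r.
Qed.

Lemma is_deriv_on_cvg f x l : is_deriv_on a b f x l ->
  f y @[y --> within `[a, b] (x^')] --> f x.
Proof.
move=> /is_deriv_onP /(_ 1 ltr01)[d d0 dP].
apply/cvgrPdist_le => e e0.
have M0 : 0 < `|l| + 1 by rewrite ltr_wpDl.
rewrite near_withinE; near=> y => yab.
have {yab}[ay yb] : a <= y /\ y <= b by move: yab; rewrite /= in_itv/= => /andP.
have : `|x - y| < Num.min d (e / (`|l| + 1)).
  near: y; apply: nbhs_dnbhs; exists (Num.min d (e / (`|l| + 1))) => //=.
  by rewrite lt_min d0 divr_gt0.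
rewrite distrC lt_min => /andP[yd ye].
have H := dP y ay yb yd; rewrite distrC.
have -> : f y - f x = (f y - f x - l * (y - x)) + l * (y - x) by rewrite subrK.
apply: le_trans (ler_normD _ _) _; rewrite normrM.
apply: (@le_trans _ _ ((`|l| + 1) * `|y - x|)); first by rewrite mulrDl addrC lerD2l -[leRHS]mul1r mul1r.
by rewrite mulrC -ler_pdivlMr// ltW.
Unshelve. all: by end_near. Qed.

Lemma is_deriv_onM f g x l m : is_deriv_on a b f x l -> is_deriv_on a b g x m ->
  is_deriv_on a b (fun y => f y * g y) x (l * g x + f x * m).
Proof.
move=> fl gm; rewrite /is_deriv_on.
have -> : (fun y => (f y * g y - f x * g x) / (y - x)) =
    (fun y => (f y - f x) / (y - x) * g y + f x * ((g y - g x) / (y - x))).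
  apply/funext => y.
  have -> : f y * g y - f x * g x = (f y - f x) * g y + f x * (g y - g x) by ring.
  by rewrite mulrDl mulrAC mulrA.
apply: cvgD; first by apply: cvgM => //; exact: is_deriv_on_cvg gm.
by apply: cvgM => //; exact: cvg_cst.
Qed.

End deriv_on_theory.

(** * Lebesgue's theorem on absolutely continuous functions *)

Section abs_continuity.
Context {R : realType}.
Notation mu := (@lebesgue_measure R).

Lemma lebesgue_measure_segment_lty (x y : R) : (mu `[x, y]%classic < +oo)%E.
Proof. by rewrite lebesgue_measure_itv/=; case: ifP; rewrite ?ltry. Qed.

(** Degenerate intervals [u i = v i] are allowed, so that clipping a family at a point keeps its
    index set. *)
Definition interval_family (x y : R) (O : set R) n (u v : 'I_n -> R) :=
  [/\ forall i, [/\ x <= u i, u i <= v i & v i <= y],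
      trivIset [set: 'I_n] (fun i => `]u i, v i[%classic) &
      forall i, `]u i, v i[ `<=` O].

Lemma interval_family_length (x y : R) (O : set R) n (u v : 'I_n -> R) :
  measurable O -> interval_family x y O u v ->
  ((\sum_(i < n) (v i - u i))%:E <= mu O)%E.
Proof.
move=> mO [uv tI sO].
have muv i : mu `]u i, v i[%classic = (v i - u i)%:E.
  have [_ le_uv _] := uv i.
  rewrite lebesgue_measure_itv/= lte_fin; case: ifPn => [//|].
  rewrite -leNgt => le_vu; rewrite (_ : v i = u i) ?subrr//.
  by apply/eqP; rewrite eq_le le_uv le_vu.
have -> : ((\sum_(i < n) (v i - u i))%:E =
    mu (\big[setU/set0]_(i < n) `]u i, v i[%classic))%E.
  rewrite measure_bigsetU_ord// -sumEFin.
  by apply: eq_bigr => i _; exact/esym/muv.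
apply: le_measure; rewrite ?inE//.
  by apply: bigsetU_measurable => i _; exact: measurable_itv.
apply: (big_ind (fun A : set R => A `<=` O)) => // A B AO BO.
by rewrite subUset.
Qed.

(** Clipping by [min] and [max] makes an interval lying on one side of [y] degenerate on the other
    side; an interval straddling [y] is cut in two, and the triangle inequality applies. *)
Lemma interval_family_split (k : R -> R) (x y z : R) (O : set R) n (u v : 'I_n -> R) :
  x <= y -> y <= z -> interval_family x z O u v ->
  [/\ interval_family x y O (fun i => Num.min (u i) y) (fun i => Num.min (v i) y),
      interval_family y z O (fun i => Num.max (u i) y) (fun i => Num.max (v i) y) &
      \sum_(i < n) `|k (v i) - k (u i)| <=
      \sum_(i < n) `|k (Num.min (v i) y) - k (Num.min (u i) y)| +
      \sum_(i < n) `|k (Num.max (v i) y) - k (Num.max (u i) y)|].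
Proof.
move=> xy yz [uv tI sO].
have smin i : `]Num.min (u i) y, Num.min (v i) y[%classic `<=` `]u i, v i[%classic.
  move=> t /=; rewrite !in_itv/= gt_min lt_min => /andP[/orP[ut|yt] /andP[tv ty]].
    by rewrite ut tv.
  by have := lt_trans yt ty; rewrite ltxx.
have smax i : `]Num.max (u i) y, Num.max (v i) y[%classic `<=` `]u i, v i[%classic.
  move=> t /=; rewrite !in_itv/= gt_max lt_max => /andP[/andP[ut yt] /orP[tv|ty]].
    by rewrite ut tv.
  by have := lt_trans yt ty; rewrite ltxx.
have tsub (A B : 'I_n -> set R) : (forall i, A i `<=` B i) ->
    trivIset [set: 'I_n] B -> trivIset [set: 'I_n] A.
  move=> AB tB i j _ _ [t [Ait Ajt]]; apply: tB => //; exists t; split; exact: AB.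
split.
- split=> [i||i]; last exact: subset_trans (smin i) (sO i).
    have [xu le_uv vz] := uv i.
    by split; rewrite ?le_min ?ge_min ?xu ?xy ?le_uv ?lexx ?orbT.
  exact: tsub tI.
- split=> [i||i]; last exact: subset_trans (smax i) (sO i).
    have [xu le_uv vz] := uv i.
    by split; rewrite ?ge_max ?le_max ?vz ?yz ?le_uv ?lexx ?orbT.
  exact: tsub tI.
- rewrite -big_split/=; apply: ler_sum => i _.
  have [xu le_uv vz] := uv i.
  case: (leP (v i) y) => [vy|yv].
    have uy := le_trans le_uv vy.
    by rewrite !(min_idPl uy) !(max_idPr uy) subrr normr0 addr0.
  case: (leP (u i) y) => [uy|yu].
    by rewrite addrC ler_distD.
  by rewrite subrr normr0 add0r.
Qed.

(** Absolute continuity for e = 1 bounds the variation by 1 on any stretch shorter than [d].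
    Finitely many stretches of length [d / 2] cover the segment, and families are split at their
    ends. *)
Lemma abs_continuous_bounded_variation (a b : R) (k : R -> R) :
  a < b -> abs_continuous_on a b k ->
  exists W : R, forall (O : set R) n (u v : 'I_n -> R), interval_family a b O u v ->
    \sum_(i < n) `|k (v i) - k (u i)| <= W.
Proof.
move=> ab /(_ 1 ltr01)[d d0 kd].
have H m x : a <= x -> x <= b -> x <= a + m%:R * (d / 2) ->
   forall (O : set R) n (u v : 'I_n -> R), interval_family a x O u v ->
    \sum_(i < n) `|k (v i) - k (u i)| <= m%:R.
  elim: m x => [|m IH] x ax xb xm O n u v uvf.
    rewrite big1// => i _; have [/(_ i)[au uv vx] _ _] := uvf.
    rewrite mul0r addr0 in xm.
    have -> : v i = u i.
      by apply/eqP; rewrite eq_le uv andbT (le_trans vx)// (le_trans xm).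
    by rewrite subrr normr0.
  have [xy|yx] := leP x (a + m%:R * (d / 2)).
    by apply: le_trans (IH _ ax xb xy _ _ _ _ uvf) _; rewrite ler_nat.
  set y := a + _ in yx.
  have ay : a <= y by rewrite lerDl mulr_ge0// divr_ge0// ltW.
  have [fl fr le_sum] := interval_family_split k ay (ltW yx) uvf.
  apply: le_trans le_sum _; rewrite -natr1 lerD//.
    apply: IH fl => //; exact: le_trans (ltW yx) xb.
  have [frb frt frO] := fr.
  apply/ltW/kd => // [i|].
    have [yu uv vx] := frb i; split => //; first exact: le_trans yu.
    exact: le_trans xb.
  rewrite -lte_fin; apply: (@le_lt_trans _ _ (mu `]y, x[%classic)).
    apply: (@interval_family_length y x) => //; split => // i t /=.
    have [yu uv vx] := frb i.
    rewrite !in_itv/= => /andP[ut tv]; apply/andP; split.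
      exact: le_lt_trans ut.
    exact: lt_le_trans vx.
  rewrite lebesgue_measure_itv/= lte_fin yx -EFinB lte_fin.
  rewrite /y; move: xm; rewrite -natr1 mulrDl mul1r; lra.
pose N := Num.trunc ((b - a) / (d / 2)).
exists N.+1%:R => O n u v; apply: (H N.+1 b) => //; first exact: ltW.
rewrite -lerBlDl -ler_pdivrMr ?divr_gt0//.
by rewrite ltW// truncnS_gt.
Qed.

(* The variation of [k] on [a, x], using only subintervals of [O]. *)
Definition variation_on (k : R -> R) (a : R) (O : set R) (x : R) : R :=
  sup [set s : R | exists n (u v : 'I_n -> R), interval_family a x O u v /\
    s = \sum_(i < n) `|k (v i) - k (u i)|].

Section variation_on.
Variables (k : R -> R) (a b W : R) (O : set R).
Hypothesis bvW : forall (O : set R) n (u v : 'I_n -> R), interval_family a b O u v ->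
    \sum_(i < n) `|k (v i) - k (u i)| <= W.

Let S x : set R := [set s : R | exists n (u v : 'I_n -> R), interval_family a x O u v /\
    s = \sum_(i < n) `|k (v i) - k (u i)|].

Let S0 x : S x 0.
Proof.
exists 0%N, (fun=> 0), (fun=> 0); split; last by rewrite big_ord0.
by split => [[]|[]|[]].
Qed.

Let SS x y : x <= y -> S x `<=` S y.
Proof.
move=> xy _ [n [u [v [[uv tI uvO] ->]]]]; exists n, u, v; split => //; split => // i.
by have [? ? vx] := uv i; split => //; exact: le_trans xy.
Qed.

Let supS x : x <= b -> has_sup (S x).
Proof.
move=> xb; split; first by exists 0.
by exists W => _ /(SS xb) [n [u [v [/bvW uvW ->]]]].
Qed.

Lemma variation_on_ge0 x : x <= b -> 0 <= variation_on k a O x.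
Proof. by move=> xb; apply: ub_le_sup (S0 x); case: (supS xb). Qed.

Lemma le_variation_on x y : x <= y -> y <= b ->
  variation_on k a O x <= variation_on k a O y.
Proof.
move=> xy yb; apply: le_sup; last exact: supS.
  by move=> s /(SS xy) Ss; exists s.
by exists 0; exact: S0.
Qed.

(** Any family for [a, x] extends by the single interval ]x, y[, which meets none of the others. In
    the proof this interval gets index 0. *)
Lemma variation_on_add x y : a <= x -> x <= y -> y <= b -> `]x, y[ `<=` O ->
  variation_on k a O x + `|k y - k x| <= variation_on k a O y.
Proof.
move=> ax xy yb xyO; rewrite -lerBrDr; apply: ge_sup; first by exists 0; exact: S0.
move=> _ [n [u [v [[uv tI uvO] ->]]]]; rewrite lerBrDr.
apply: ub_le_sup; first by case: (supS yb).
exists n.+1, (fun i => oapp u x (unlift ord0 i)), (fun i => oapp v y (unlift ord0 i)).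
split; last first.
  rewrite big_ord_recl unlift_none/= addrC; congr (_ + _).
  by apply: eq_bigr => i _; rewrite liftK.
have disj i t : `]u i, v i[%classic t -> `]x, y[%classic t -> False.
  have [_ _ vx] := uv i.
  rewrite /= !in_itv/= => /andP[_ tv] /andP[xt _].
  by have := lt_trans xt (lt_le_trans tv vx); rewrite ltxx.
split.
- move=> i; case: unliftP => [j _|_]//=.
  by have [? ? vx] := uv j; split => //; exact: le_trans xy.
- move=> i j _ _; case: unliftP => [i' ->|->]; case: unliftP => [j' ->|->]//=.
  + by move=> ij; congr lift; exact: tI.
  + by move=> [t [/disj]].
  + by move=> [t [/[swap]/disj]].
- by move=> i; case: unliftP => [j _|_]//=.
Qed.

Lemma variation_on_le x (e : R) :
  (forall n (u v : 'I_n -> R), interval_family a x O u v ->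
    \sum_(i < n) `|k (v i) - k (u i)| <= e) -> variation_on k a O x <= e.
Proof.
by move=> uve; apply: ge_sup; [exists 0; exact: S0|move=> _ [n [u [v [/uve ? ->]]]]].
Qed.

End variation_on.

(** Take the supremum of the points where [T] is at least [T a]. The second hypothesis, which limits
    downward jumps on arrival from the left, puts it in the set; the first then excludes that it
    lies before [b]. *)
Lemma creeping_le (T : R -> R) (a b : R) : a <= b ->
  (forall x, a <= x -> x < b -> exists y, [/\ x < y, y <= b & T x <= T y]) ->
  (forall x e : R, a < x -> x <= b -> 0 < e -> exists2 d : R, 0 < d &
     forall y, a <= y -> x - d < y -> y < x -> T y <= T x + e) ->
  T a <= T b.
Proof.
move=> ab step clos.
pose S := [set x | [/\ a <= x, x <= b & T a <= T x]].
have Sa : S a by [].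
have supS : has_sup S by split; [exists a | exists b => x []].
pose s := sup S.
have as_ : a <= s by apply: ub_le_sup Sa; case: supS.
have sb : s <= b by apply: ge_sup; [exists a | move=> x []].
have Ts : T a <= T s.
  apply/ler_addgt0Pr => e e0; have [Ss|nSs] := pselect (S s).
    by case: Ss => _ _ /le_trans; apply; rewrite lerDl ltW.
  have as' : a < s.
    by rewrite lt_neqAle as_ andbT; apply/eqP => sa; apply: nSs; rewrite -sa.
  have [d d0 dT] := clos s e as' sb e0.
  have [y Sy sdy] := sup_adherent d0 supS.
  have [ay yb Tay] := Sy.
  apply: le_trans Tay _; apply: dT => //.
  rewrite lt_neqAle; apply/andP; split; first by apply/eqP => ys; apply: nSs; rewrite -ys.
  by apply: ub_le_sup Sy; case: supS.
have [sb'|bs] := ltP s b; last by have <- : s = b by apply/eqP; rewrite eq_le sb bs.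
have [y [sy yb Tsy]] := step s as_ sb'.
have : y <= s.
  apply: ub_le_sup; first by case: supS.
  by split => //; [exact: le_trans as_ (ltW sy)|exact: le_trans Tsy].
by rewrite leNgt sy.
Qed.

Lemma derivable_slope (G : R -> R) (x l : R) : derivable G x 1 -> derive1 G x = l ->
  forall e : R, 0 < e -> exists2 d : R, 0 < d & forall y, `|y - x| < d ->
    `|G y - G x - l * (y - x)| <= e * `|y - x|.
Proof.
move=> dG <- e e0.
have /cvgrPdist_le/(_ e e0) : h^-1 *: (G (h *: 1 + x) - G x) @[h --> 0^'] --> derive1 G x.
  by rewrite derive1E; exact: dG.
move=> /= [d /= d0 dP]; exists d => // y yxd.
have [->|yx] := eqVneq y x; first by rewrite !subrr mulr0 subr0 normr0 mulr0.
have := dP (y - x); rewrite /ball_/= sub0r normrN => /(_ yxd).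
rewrite subr_eq0 => /(_ yx); rewrite scaler1 subrK => H.
have yx0 : 0 < `|y - x| by rewrite normr_gt0 subr_eq0.
have -> : G y - G x - derive1 G x * (y - x) =
    - (derive1 G x - (y - x)^-1 *: (G y - G x)) * (y - x).
  by rewrite /GRing.scale/=; field; rewrite subr_eq0.
by rewrite normrM normrN ler_pM2r.
Qed.

(* Let G be the primitive of H. Off a null set, F - G + e x goes up by a small
   step to the right, by hypothesis and Lebesgue differentiation. The null set is
   covered by a small open set O, where the drops of F are absorbed by the
   monotone function B, and those of - G by the integral of |H| over O; both
   together grow by at most 2 e on [a, b], so [creeping_le] applies to the sum. *)
Lemma dini_le_integral (F H : R -> R) (a b : R) : a < b ->
  mu.-integrable `[a, b] (EFin \o H) ->
  {ae mu, forall x, a <= x -> x < b -> forall e d : R, 0 < e -> 0 < d ->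
     exists y, [/\ x < y, y < x + d, y <= b & (H x - e) * (y - x) <= F y - F x]} ->
  (forall e : R, 0 < e -> exists2 d : R, 0 < d & forall O : set R, open O -> (mu O < d%:E)%E ->
     exists B : R -> R, [/\ forall x y, a <= x -> x <= y -> y <= b -> B x <= B y,
       B b - B a <= e &
       forall x y, a <= x -> x < y -> y <= b -> `]x, y[ `<=` O ->
         F x - F y <= B y - B x]) ->
  (forall x e : R, a < x -> x <= b -> 0 < e -> exists2 d : R, 0 < d &
     forall y, a <= y -> x - d < y -> y < x -> F y <= F x + e) ->
  \int[mu]_(x in `[a, b]) H x <= F b - F a.
Proof.
move=> ab iH aeF budget clos.
pose H0 := H \_ `[a, b].
have iH0 : mu.-integrable setT (EFin \o H0).
  by rewrite -restrict_EFin; apply/integrable_restrict => //=; rewrite setTI.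
have iH0S (D : set R) : measurable D -> mu.-integrable D (EFin \o H0).
  by move=> mD; exact: integrableS iH0.
have iNH0S (D : set R) : measurable D -> mu.-integrable D (EFin \o (fun x => `|H0 x|)).
  by move=> mD; exact/integrable_norm/iH0S.
pose G y := \int[mu]_(x in `[a, y]) H0 x.
have GB x y : a <= x -> x <= y -> G y - G x = \int[mu]_(t in `]x, y]) H0 t.
  by move=> ax xy; apply: Rintegral_itvB => //; exact: iH0S.
have small (e : R) : 0 < e -> exists2 d : R, 0 < d & forall A : set R, measurable A ->
    (mu A < d%:E)%E -> \int[mu]_(x in A) `|H0 x| < e.
  by move=> e0; have [d [d0 dP]] := integral_normr_continuous iH0 e0; exists d.
have aeG : {ae mu, forall x, a < x -> x < b -> derivable G x 1 /\ derive1 G x = H0 x}.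
  have := lebesgue_differentiation (integrable_locally (measurable_itv `[a, b]) iH).
  apply: filterS; first exact: (ae_filter_ringOfSetsType mu).
  move=> x Hx ax xb.
  by apply: (@FTC1_lebesgue_pt _ _ _ _ b) => //; exact: iH0S.
have [A [mA A0 sA]] := @filterI _ _ (ae_filter_ringOfSetsType mu) _ _ aeF aeG.
have {}sA x : ~ A x -> a < x -> x < b ->
   (forall e d : R, 0 < e -> 0 < d ->
     exists y, [/\ x < y, y < x + d, y <= b & (H0 x - e) * (y - x) <= F y - F x]) /\
   derivable G x 1 /\ derive1 G x = H0 x.
  move=> nAx ax xb.
  have [h1 h2] : [set x | a <= x -> x < b -> forall e d : R, 0 < e -> 0 < d ->
     exists y, [/\ x < y, y < x + d, y <= b & (H x - e) * (y - x) <= F y - F x]] x /\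
     (a < x -> x < b -> derivable G x 1 /\ derive1 G x = H0 x).
    by apply: contrapT => /sA.
  split; last exact: h2.
  rewrite (_ : H0 x = H x); first exact: h1 (ltW ax) xb.
  by rewrite /H0 patchE mem_set//= in_itv/= !ltW.
(* The error consists of [e * (b - a)] from the tilt, [e] from the growth of [B], and [e] from the
   integral of |H| over the open set. *)
suff key (e : R) : 0 < e -> G b <= F b - F a + e * (b - a + 2).
  have -> : \int[mu]_(x in `[a, b]) H x = G b.
    by apply: eq_Rintegral => x xab; rewrite /H0 patchE xab.
  apply/ler_addgt0Pr => e e0.
  have := key (e / (b - a + 2)); rewrite divfK; last by rewrite gt_eqF//; lra.
  by apply; rewrite divr_gt0//; lra.
move=> e0.
have [d1 d10 d1P] := budget e e0.
have [d2 d20 d2P] := small e e0.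
(* The endpoint [a] joins the exceptional set because the primitive [G] is differentiated only at
   interior points. *)
pose A' := A `|` [set a].
have mA' : measurable A' by exact: measurableU.
have A'0 : mu A' = 0%E.
  by apply: null_set_setU => //; exact: lebesgue_measure_set1.
have A'fin : (mu A' < +oo)%E by rewrite A'0.
have [U [oU A'U Ud]] : exists U : set R, [/\ open U, A' `<=` U & (mu U < (Num.min d1 d2)%:E)%E].
  have d120 : 0 < Num.min d1 d2 by rewrite lt_min d10.
  have [U [oU AU muU]] := lebesgue_regularity_outer mA' A'fin d120.
  exists U; split => //; apply: le_lt_trans muU.
  have mU : measurable U by exact: open_measurable.
  rewrite -[leRHS]adde0 -[X in (_ + X)%E]A'0.
  apply: le_trans (measureU2 _ _ _) => //; last exact: measurableD.
  apply: le_measure; rewrite ?inE//.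
    by apply: measurableU => //; exact: measurableD.
  by move=> x Ux; have [A'x|nA'x] := pselect (A' x); [right|left].
have mU : measurable U by exact: open_measurable.
have [B [Bmono Bab BF]] : exists B : R -> R, [/\ forall x y, a <= x -> x <= y -> y <= b -> B x <= B y,
       B b - B a <= e &
       forall x y, a <= x -> x < y -> y <= b -> `]x, y[ `<=` U ->
         F x - F y <= B y - B x].
  by apply: d1P => //; apply: lt_le_trans Ud _; rewrite lee_fin ge_min lexx.
pose NH := (fun x => `|H0 x|) \_ U.
have iNH (D : set R) : measurable D -> mu.-integrable D (EFin \o NH).
  move=> mD; apply: (@integrableS _ _ _ _ setT) => //.
  rewrite -restrict_EFin; apply/integrable_restrict => //=; rewrite setTI.
  exact: iNH0S.
have NH_ge0 x : 0 <= NH x by rewrite /NH patchE; case: ifPn.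
pose I x := \int[mu]_(t in `[a, x]) NH t.
have IB x y : a <= x -> x <= y -> I y - I x = \int[mu]_(t in `]x, y]) NH t.
  by move=> ax xy; apply: Rintegral_itvB => //; exact: iNH.
have Imono x y : a <= x -> x <= y -> I x <= I y.
  by move=> ax xy; rewrite -subr_ge0 IB//; apply: Rintegral_ge0.
have Ib : I b <= e.
  apply: ltW; apply: (@le_lt_trans _ _ (\int[mu]_(x in U) `|H0 x|)); last first.
    by apply: d2P => //; apply: lt_le_trans Ud _; rewrite lee_fin ge_min lexx orbT.
  rewrite /I /NH -Rintegral_mkcondr.
  rewrite /Rintegral fine_le//.
  + by apply: integrable_fin_num; [exact: measurableI|apply: iNH0S; exact: measurableI].
  + by apply: integrable_fin_num => //; exact: iNH0S.
  + apply: ge0_subset_integral => //=; first exact: measurableI.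
    exact: (measurable_int _ (iNH0S _ mU)).
have Ia : I a = 0 by rewrite /I set_itv1 Rintegral_set1.
have Ga : G a = 0 by rewrite /G set_itv1 Rintegral_set1.
pose T x := F x - G x + e * (x - a) + B x + I x.
suff : T a <= T b.
  rewrite /T Ga Ia subrr mulr0 subr0 !addr0.
  by move: Bab Ib; lra.
apply: (@creeping_le T a b (ltW ab)) => [x ax xb|x e' ax xb e'0].
- have [A'x|nA'x] := pselect (A' x).
    have [d /= d0 dU] : \forall y \near x, U y by apply: oU; exact: A'U.
    pose y := Num.min (x + d / 2) b.
    have xy : x < y by rewrite lt_min xb andbT ltrDl divr_gt0.
    have yxd : y <= x + d / 2 by rewrite ge_min lexx.
    have yb : y <= b by rewrite ge_min lexx orbT.
    have xyU : `[x, y] `<=` U.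
      move=> t /=; rewrite in_itv/= => /andP[xt ty]; apply: dU.
      rewrite /ball_/= distrC ger0_norm ?subr_ge0//; lra.
    exists y; split => //.
    have h1 : F x - F y <= B y - B x.
      by apply: BF => // t xt; apply: xyU; exact: subset_itv_oo_cc.
    have h2 : G y - G x <= I y - I x.
      rewrite GB ?IB ?(ltW xy)//.
      apply: le_Rintegral => //; [exact: iH0S|exact: iNH|].
      move=> t xyt; rewrite /NH patchE mem_set ?ler_norm//.
      by apply: xyU; exact: subset_itv_oc_cc.
    have h3 : 0 <= e * (y - x) by apply: mulr_ge0; [exact: ltW|rewrite subr_ge0 ltW].
    rewrite /T; move: h1 h2 h3; rewrite !mulrBr; lra.
  have ax' : a < x by rewrite lt_neqAle ax andbT; apply/eqP => ax'; apply: nA'x; right.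
  have [h1 [h2 h3]] : _ := sA x (fun Ax => nA'x (or_introl Ax)) ax' xb.
  (* The tilt of slope [e] pays [e / 2] for the slope of [F] and [e / 2] for that of [G]. *)
  have e20 : 0 < e / 2 by rewrite divr_gt0.
  have [d d0 dP] := derivable_slope h2 h3 e20.
  have [y [xy yxd yb hF]] := h1 _ _ e20 d0.
  exists y; split => //.
  have := dP y; rewrite gtr0_norm ?subr_gt0// ltrBlDl => /(_ yxd).
  rewrite ler_norml => /andP[_ hG].
  have := Bmono _ _ ax (ltW xy) yb; have := Imono _ _ ax (ltW xy).
  move: hF hG; rewrite /T; nra.
(* The tilt, [B] and [I] are nondecreasing, so only [F] and [- G] can be larger at [y] than at [x];
   [G] is controlled because the integral over a short interval is small. *)
- have e'20 : 0 < e' / 4 by rewrite divr_gt0.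
  have [d d0 dP] := clos _ _ ax xb e'20.
  have [d' d'0 d'P] := small _ e'20.
  have e'e : 0 < e' / 4 / e by rewrite divr_gt0.
  exists (Num.min d d'); first by rewrite lt_min d0.
  move=> y ay xdy yx.
  have xdy1 : x - d < y by apply: le_lt_trans xdy; rewrite lerD2l lerN2 ge_min lexx.
  have xdy2 : x - d' < y by apply: le_lt_trans xdy; rewrite lerD2l lerN2 ge_min lexx orbT.
  have h1 := dP _ ay xdy1 yx.
  have h2 : `|G x - G y| <= e' / 4.
    rewrite GB ?(ltW yx)//.
    apply: le_trans (le_normr_Rintegral _ (iH0S _ _)) _ => //.
    apply/ltW/d'P => //; rewrite lebesgue_measure_itv/= lte_fin yx -EFinB lte_fin; lra.
  have h3 := Bmono _ _ ay (ltW yx) xb; have h4 := Imono _ _ ay (ltW yx).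
  have h5 : e * (y - a) <= e * (x - a) by rewrite ler_pM2l// lerD2r ltW.
  move: h2; rewrite ler_norml => /andP[h2 h2'].
  rewrite /T; lra.
Qed.

(** * Upper right Dini derivates *)

Definition diff_quot (K : R -> R) (x t : R) : R := (K (x + t) - K x) / t.

Definition upper_quot (K : R -> R) (n : nat) (x : R) : \bar R :=
  ereal_sup [set (diff_quot K x t)%:E | t in `]0, n.+1%:R^-1[].

(** The limsup of the quotients as t tends to 0 from the right: the suprema over 0 < t < 1/(n+1)
    decrease with n, so their limit is a countable infimum. *)
Definition upper_dini (K : R -> R) (x : R) : \bar R :=
  einfs (upper_quot K ^~ x) 0.

(** For fixed [t] the quotient is continuous in [x], so each supremum, although over uncountably
    many [t], is lower semicontinuous. *)
Lemma measurable_upper_dini (K : R -> R) : continuous K ->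
  measurable_fun setT (upper_dini K).
Proof.
move=> cK; apply: measurable_fun_einfs => n.
apply: lower_semicontinuous_measurable => x c /ereal_sup_gt[_ [t t0n <-]].
rewrite lte_fin => cq.
exists [set y | c < diff_quot K y t]; last first.
  move=> y cy; apply: (@lt_le_trans _ _ (diff_quot K y t)%:E) => //.
  by apply: ereal_sup_ubound; exists t.
have cq' : {for x, continuous (diff_quot K ^~ t)}.
  rewrite /diff_quot; apply: cvgMl; apply: cvgB; last exact: cK.
  apply: (@cvg_comp _ _ _ (fun y => y + t) K); last exact: cK.
  by apply: cvgD; [exact: cvg_id|exact: cvg_cst].
exact: (cvgr_gt _ cq').
Qed.

Lemma upper_dini_gt (K : R -> R) (x c d : R) : (c%:E < upper_dini K x)%E -> 0 < d ->
  exists t, [/\ 0 < t, t < d & c < diff_quot K x t].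
Proof.
move=> cD d0; have [n nd] : exists n : nat, n.+1%:R^-1 < d.
  exists (Num.trunc d^-1).
  by rewrite invf_plt ?posrE// truncnS_gt.
have /ereal_sup_gt[_ [t t0n <-]] : (c%:E < upper_quot K n x)%E.
  by apply: lt_le_trans cD _; apply: ereal_inf_lbound; exists n.
rewrite lte_fin => cq; exists t; split => //; move: t0n => /=; rewrite in_itv/= => /andP[]//.
by move=> _ /lt_trans; exact.
Qed.

Lemma upper_dini_lt (K : R -> R) (x c : R) : (upper_dini K x < c%:E)%E ->
  exists2 d, 0 < d & forall t, 0 < t -> t < d -> diff_quot K x t <= c.
Proof.
move=> /ereal_inf_lt[_ [n _ <-]] qc; exists n.+1%:R^-1; first by rewrite invr_gt0.
move=> t t0 tn; rewrite -lee_fin; apply: le_trans (ltW qc).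
by apply: ereal_sup_ubound; exists t => //=; rewrite in_itv/= t0.
Qed.

(** This provides the monotone function [B] of [dini_le_integral]: the variation of [k] inside [O].
    Families inside [O] have total length at most the measure of [O], so absolute continuity keeps
    this variation below [e]. *)
Lemma abs_continuous_budget (k F : R -> R) (a b y e : R) : a < b -> y <= b ->
  abs_continuous_on a b k ->
  (forall x z, a <= x -> x < z -> z <= y -> F x - F z <= `|k z - k x|) ->
  0 < e -> exists2 d : R, 0 < d & forall O : set R, open O -> (mu O < d%:E)%E ->
     exists B : R -> R, [/\ forall x z, a <= x -> x <= z -> z <= y -> B x <= B z,
       B y - B a <= e &
       forall x z, a <= x -> x < z -> z <= y -> `]x, z[ `<=` O ->
         F x - F z <= B z - B x].
Proof.
move=> ab yb ack Fk e0; have [d d0 dP] := ack e e0.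
have [W bvW] := abs_continuous_bounded_variation ab ack.
exists d => // O oO Od; exists (variation_on k a O); split.
- by move=> x z ax xz zy; apply: (le_variation_on _ bvW) => //; exact: le_trans yb.
- apply: (@le_trans _ _ (variation_on k a O y)).
    by rewrite gerBl; apply: (variation_on_ge0 _ bvW); exact: ltW.
  apply: variation_on_le => n u v uvf; apply: ltW; apply: dP.
  + move=> i; have [/(_ i)[au uv vy] _ _] := uvf; split => //; exact: le_trans yb.
  + by have [] := uvf.
  + rewrite -lte_fin; apply: le_lt_trans Od.
    by apply: interval_family_length uvf; exact: open_measurable.
- move=> x z ax xz zy xzO; apply: le_trans (Fk _ _ ax xz zy) _.
  rewrite lerBrDl; apply: (variation_on_add bvW) => //; first exact: ltW.
  exact: le_trans yb.
Qed.

(** Precomposing with this projection onto the segment extends an absolutely continuous function to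
    a continuous function on the line. *)
Definition clamp (a b x : R) : R := Num.max a (Num.min x b).

Lemma clamp_itv (a b x : R) : a <= b -> a <= clamp a b x /\ clamp a b x <= b.
Proof.
by move=> ab; rewrite /clamp le_max lexx ge_max ab ge_min lexx orbT.
Qed.

Lemma clamp_id (a b x : R) : a <= x -> x <= b -> clamp a b x = x.
Proof. by move=> ax xb; rewrite /clamp (min_idPl xb) (max_idPr ax). Qed.

Lemma clamp_lipschitz (a b x y : R) : x <= y ->
  clamp a b x <= clamp a b y /\ clamp a b y - clamp a b x <= y - x.
Proof.
move=> xy; rewrite /clamp.
by case: (leP x b); case: (leP y b) => ? ?;
  rewrite /Num.max; do ?case: ifP; move=> *; split; lra.
Qed.

Lemma abs_continuous_lt (k : R -> R) (a b e : R) : abs_continuous_on a b k -> 0 < e ->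
  exists2 d, 0 < d & forall x y, a <= x -> x <= y -> y <= b -> y - x < d -> `|k y - k x| < e.
Proof.
move=> ack e0; have [d d0 dP] := ack e e0; exists d => // x y ax xy yb yxd.
have := dP 1%N (fun=> x) (fun=> y); rewrite !big_ord1; apply => //.
by move=> i j _ _ _; rewrite !ord1.
Qed.

Lemma abs_continuous_clamp_continuous (k : R -> R) (a b : R) : a <= b ->
  abs_continuous_on a b k -> continuous (k \o clamp a b).
Proof.
move=> ab ack x; apply/cvgrPdist_lt => e e0.
have [d d0 dP] := abs_continuous_lt ack e0.
near=> y.
have yx : `|x - y| < d by near: y; exists d.
have [xy|yx'] := leP x y.
  have [h1 h2] := clamp_lipschitz a b xy.
  have [h3 _] := clamp_itv x ab; have [_ h4] := clamp_itv y ab.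
  rewrite /= distrC; apply: dP => //; apply: le_lt_trans h2 _.
  by rewrite distrC in yx; exact: le_lt_trans (ler_norm _) yx.
have [h1 h2] := clamp_lipschitz a b (ltW yx').
have [h3 _] := clamp_itv y ab; have [_ h4] := clamp_itv x ab.
rewrite /=; apply: dP => //; apply: le_lt_trans h2 _.
exact: le_lt_trans (ler_norm _) yx.
Unshelve. all: by end_near. Qed.

(** * Absolutely continuous functions as integrals of a Dini derivate *)

Section abs_continuous_integral.
Variables (a b : R) (k : R -> R).
Hypotheses (ab : a < b) (ack : abs_continuous_on a b k).
Let K := k \o clamp a b.
Let cK : continuous K := abs_continuous_clamp_continuous (ltW ab) ack.
Let D := upper_dini K.
Let mD : measurable_fun setT D := measurable_upper_dini cK.

Let Kk x : a <= x -> x <= b -> K x = k x.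
Proof. by move=> ax xb; rewrite /K/= clamp_id. Qed.

Let Kincr x t : a <= x -> 0 < t -> x + t <= b -> k (x + t) - k x = diff_quot K x t * t.
Proof.
move=> ax t0 xtb; rewrite /diff_quot divfK ?gt_eqF// !Kk//.
- by apply: le_trans xtb; rewrite lerDl ltW.
- by apply: le_trans ax _; rewrite lerDl ltW.
Qed.

(* Since the quotients of [k] are dominated by those of its variation, the
   truncations of |D| have integrals bounded by the total variation. *)
Lemma integrable_upper_dini : mu.-integrable `[a, b] D.
Proof.
have [W bvW] := abs_continuous_bounded_variation ab ack.
apply/integrableP; split; first exact: measurable_funTS.
(* The truncations are bounded, hence integrable before anything is known of [D]; [dini_le_integral]
   applies to them, and monotone convergence passes to |D|. *)
pose g (n : nat) x := mine `|D x|%E n%:R%:E.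
have mg n : measurable_fun `[a, b] (g n).
  apply: measurable_mine => //; apply: measurableT_comp => //.
  exact: measurable_funTS.
have g0 n x : (0 <= g n x)%E by rewrite /g le_min abse_ge0/= lee_fin.
have gfin n x : g n x \is a fin_num.
  rewrite ge0_fin_numE//; apply: (@le_lt_trans _ _ n%:R%:E); last exact: ltry.
  by rewrite ge_min lexx orbT.
have gW n : (\int[mu]_(x in `[a, b]) g n x <= W%:E)%E.
  have ig : mu.-integrable `[a, b] (EFin \o (fine \o g n)).
    apply: measurable_bounded_integrable => //.
    - exact: lebesgue_measure_segment_lty.
    - by apply: measurableT_comp => //; exact: mg.
    - exists n%:R; split => // y ny x _ /=.
      rewrite ger0_norm ?fine_ge0//; apply: le_trans (ltW ny).
      by rewrite -lee_fin fineK// ge_min lexx orbT.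
  have -> : (\int[mu]_(x in `[a, b]) g n x = (\int[mu]_(x in `[a, b]) fine (g n x))%:E)%E.
    rewrite /Rintegral fineK; last exact: integrable_fin_num.
    by apply: eq_integral => x _; rewrite fineK.
  rewrite lee_fin.
  pose V := variation_on k a setT.
  apply: (@le_trans _ _ (V b - V a)); last first.
    apply: (@le_trans _ _ (V b)).
      by rewrite gerBl; apply: (variation_on_ge0 _ bvW); exact: ltW.
    by apply: variation_on_le => m u v; exact: bvW.
  apply: dini_le_integral => //.
  - apply: aeW => x ax xb e d e0 d0.
    suff [t [t0 td txb tq]] : exists t, [/\ 0 < t, t < d, t < b - x &
        fine (g n x) - e <= `|diff_quot K x t|].
      exists (x + t); split; rewrite ?ltrDl ?ltrD2l//; first lra.
      rewrite addrAC subrr add0r.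
      have : V x + `|k (x + t) - k x| <= V (x + t).
        apply: (variation_on_add bvW) => //; last lra.
        by rewrite lerDl ltW.
      rewrite Kincr//; last lra.
      rewrite normrM (gtr0_norm t0).
      by rewrite lerBrDl; apply: le_trans; rewrite lerD2l ler_pM2r.
    have gD : (g n x <= `|D x|)%E by rewrite ge_min lexx.
    have dx0 : 0 < Num.min d (b - x) by rewrite lt_min d0 subr_gt0.
    (* If the derivate is nonnegative, some quotient comes close to it from below. If it is
       negative, all quotients for small [t] are at most [- (g n x - e)], and half the smallest
       bound serves as [t]. *)
    have [D0|D0] := leP 0%E (D x).
      have [|t [t0 + tq]] := @upper_dini_gt K x (fine (g n x) - e) _ _ dx0.
        apply: (@lt_le_trans _ _ (g n x)); last by rewrite (gee0_abs D0) in gD.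
        by rewrite -[ltRHS]fineK// lte_fin ltrBlDr ltrDl.
      rewrite lt_min => /andP[td tbx]; exists t; split => //.
      by apply: ltW; apply: lt_le_trans tq _; exact: ler_norm.
    have [|d' d'0 d'P] := @upper_dini_lt K x (- (fine (g n x) - e)).
      apply: (@le_lt_trans _ _ (- g n x)%E).
        by rewrite leeNr; rewrite (lte0_abs D0) in gD.
      by rewrite -[in ltLHS](fineK (gfin n x)) -EFinN lte_fin ltrN2 ltrBlDr ltrDl.
    pose t := Num.min (Num.min d (b - x)) d' / 2.
    have m0 : 0 < Num.min (Num.min d (b - x)) d' by rewrite lt_min dx0.
    have t0 : 0 < t by rewrite divr_gt0.
    have tm : t < Num.min (Num.min d (b - x)) d' by rewrite /t; lra.
    move: tm; rewrite !lt_min => /andP[/andP[td tbx] td'].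
    exists t; split => //; have := d'P _ t0 td'; rewrite lerNr => /le_trans; apply.
    by rewrite -normrN ler_norm.
  (* The variation [V] never drops, so the zero function absorbs its drops. *)
  - move=> e e0; exists 1 => // O _ _; exists (fun=> 0); split=> //.
      by rewrite subrr ltW.
    move=> x y ax xy yb _; rewrite subrr subr_le0.
    by apply: (le_variation_on _ bvW) => //; exact: ltW.
  - move=> x e ax xb e0; exists 1 => // y ay _ yx.
    apply: (@le_trans _ _ (V x)); last by rewrite lerDl ltW.
    by apply: (le_variation_on _ bvW) => //; exact: ltW.
have -> : (\int[mu]_(x in `[a, b]) `|D x| = limn (fun n => \int[mu]_(x in `[a, b]) g n x))%E.
  rewrite -monotone_convergence//; last first.
    move=> x _ m n mn; rewrite /g le_min ge_min lexx/= ge_min lee_fin ler_nat mn orbT.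
    by [].
  apply: eq_integral => x _; apply/esym/cvg_lim => //.
  have [Dfin|] := boolP (D x \is a fin_num).
    apply: cvg_near_cst.
    exists (Num.trunc (fine `|D x|%E)).+1 => // m /= mn.
    rewrite /g; apply/min_idPl.
    rewrite -[leLHS]fineK ?abse_fin_num// lee_fin ltW//.
    by apply: lt_le_trans (truncnS_gt _) _; rewrite ler_nat.
  rewrite fin_numE negb_and !negbK => Dinf.
  have Dy : (`|D x| = +oo)%E by case/orP: Dinf => /eqP ->.
  rewrite Dy /g (_ : (fun n => mine `|D x|%E n%:R%:E) = (fun n => n%:R%:E)).
    exact/cvgeryP/cvgr_idn.
  by apply/funext => n; rewrite Dy; apply/min_idPr; rewrite leey.
apply: (@le_lt_trans _ _ W%:E); last exact: ltry.
apply: lime_le; last by near=> n; exact: gW.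
apply: ereal_nondecreasing_is_cvgn => m n mn.
apply: ge0_le_integral; [by []|by move=> *; exact: g0|exact: mg|exact: mg|move=> x _].
by rewrite /g le_min ge_min lexx/= ge_min lee_fin ler_nat mn orbT.
Unshelve. all: by end_near. Qed.

Lemma abs_continuous_cvg_left (x e : R) : a < x -> x <= b -> 0 < e ->
  exists2 d : R, 0 < d & forall y, a <= y -> x - d < y -> y < x -> `|k x - k y| < e.
Proof.
move=> ax xb e0; have [d d0 dP] := abs_continuous_lt ack e0.
by exists d => // y ay xdy yx; apply: dP => //; [exact: ltW|lra].
Qed.

(* [h] is the upper right Dini derivate of [k]; comparing [k] and then [- k] with
   its integral through [dini_le_integral] gives both inequalities. *)
Lemma abs_continuous_FTC : exists h : R -> R,
  [/\ mu.-integrable `[a, b] (EFin \o h),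
      forall x, a <= x -> x <= b -> k x - k a = \int[mu]_(t in `[a, x]) h t &
      {ae mu, forall x, a < x -> x < b -> is_deriv_on a b k x (h x)}].
Proof.
pose h := fine \o D; have iD := integrable_upper_dini.
have ih : mu.-integrable `[a, b] (EFin \o h).
  apply: le_integrable iD => //.
    apply/measurable_EFinP; apply: measurableT_comp => //.
    exact: measurable_funTS.
  by move=> x _; rewrite /h/=; case: (D x) => [r||] /=; rewrite ?normr0 ?leey.
have fD := @integrable_ae _ _ _ mu _ (measurable_itv `[a, b]) _ iD.
have FTC x : a <= x -> x <= b -> k x - k a = \int[mu]_(t in `[a, x]) h t.
  move=> ax xb; move: (ax); rewrite le_eqVlt => /predU1P[<-|ax'].
    by rewrite set_itv1 Rintegral_set1 subrr.
  have ihx : mu.-integrable `[a, x] (EFin \o h).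
    by apply: integrableS ih => //; exact: subset_itvl.
  (* For [- k] every small step works, as the limsup bounds all short quotients of [k] from above.
     For [k] only some small steps work, which suffices since [dini_le_integral] asks for one step
     at each scale. *)
  apply/eqP; rewrite eq_le; apply/andP; split.
    have : \int[mu]_(t in `[a, x]) (- h t) <= - k x - (- k a).
      apply: (@dini_le_integral (fun x => - k x) (fun x => - h x) a x) => //.
      - exact: integrableN ihx.
      - apply: filterS fD.
        move=> y fDy ay yx e d e0 d0.
        have /fDy {}fDy : `[a, b]%classic y by rewrite /= in_itv/= ay (ltW (lt_le_trans yx xb)).
        have [|d' d'0 d'P] := @upper_dini_lt K y (h y + e).
          by rewrite -[ltLHS](fineK fDy) lte_fin ltrDl.
        pose t := Num.min (Num.min d (x - y)) d' / 2.
        have m0 : 0 < Num.min (Num.min d (x - y)) d' by rewrite !lt_min d0 subr_gt0 yx.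
        have t0 : 0 < t by rewrite divr_gt0.
        have tm : t < Num.min (Num.min d (x - y)) d' by rewrite /t; lra.
        move: tm; rewrite !lt_min => /andP[/andP[td tbx] td'].
        exists (y + t); rewrite ltrDl t0 ltrD2l td; split => //; first lra.
        rewrite addrAC subrr add0r.
        have := Kincr ay t0; have -> : (y + t <= b) = true by lra.
        move=> /(_ isT) kq.
        have -> : - k (y + t) - - k y = - (k (y + t) - k y) by rewrite opprD opprK.
        rewrite kq -mulNr ler_pM2r//.
        have := d'P _ t0 td'; lra.
      - move=> e e0; apply: (abs_continuous_budget ab xb ack) => // y z _ _ _.
        by rewrite opprK addrC ler_norm.
      - move=> y e ay yx e0.
        have [d d0 dP] := abs_continuous_cvg_left ay (le_trans yx xb) e0.
        exists d => // z az ydz zy; have := dP z az ydz zy.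
        by rewrite ltr_norml => /andP[_]; lra.
    have -> : \int[mu]_(t in `[a, x]) (- h t) = - \int[mu]_(t in `[a, x]) h t.
      by rewrite -mulN1r -RintegralZl//; apply: eq_Rintegral => t _; rewrite mulN1r.
    by rewrite lerNl opprB opprK addrC.
  apply: dini_le_integral => //.
  - apply: filterS fD.
    move=> y fDy ay yx e d e0 d0.
    have /fDy {}fDy : `[a, b]%classic y by rewrite /= in_itv/= ay (ltW (lt_le_trans yx xb)).
    have dx0 : 0 < Num.min d (x - y) by rewrite lt_min d0 subr_gt0.
    have [|t [t0 + tq]] := @upper_dini_gt K y (h y - e) _ _ dx0.
      by rewrite -[ltRHS](fineK fDy) lte_fin ltrBlDr ltrDl.
    rewrite lt_min => /andP[td tbx].
    exists (y + t); rewrite ltrDl t0 ltrD2l td; split => //; first lra.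
    rewrite addrAC subrr add0r.
    have := Kincr ay t0; have -> : (y + t <= b) = true by lra.
    by move=> /(_ isT) ->; rewrite ler_pM2r// ltW.
  - move=> e e0; apply: (abs_continuous_budget ab xb ack) => // y z _ _ _.
    by rewrite distrC ler_norm.
  - move=> y e ay yx e0.
    have [d d0 dP] := abs_continuous_cvg_left ay (le_trans yx xb) e0.
    exists d => // z az ydz zy; have := dP z az ydz zy.
    by rewrite ltr_norml => /andP[+ _]; lra.
exists h; split => //.
(* Once [k] is a primitive of [h], Lebesgue differentiation of [h] upgrades the one-sided derivate
   to a derivative almost everywhere. *)
pose h0 := h \_ `[a, b].
have ih0 (A : set R) : measurable A -> mu.-integrable A (EFin \o h0).
  move=> mA; apply: (@integrableS _ _ _ _ setT) => //.
  by rewrite -restrict_EFin; apply/integrable_restrict => //=; rewrite setTI.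
have := lebesgue_differentiation (integrable_locally (measurable_itv `[a, b]) ih).
apply: filterS; first exact: (ae_filter_ringOfSetsType mu).
move=> x Hx ax xb.
have [dG Gx] := @FTC1_lebesgue_pt _ h0 (BLeft a) x b xb (ih0 _ (measurable_itv _)) ax Hx.
have {}Gx : derive1 (fun y => \int[mu]_(t in `[a, y]) h0 t) x = h x.
  by rewrite [LHS]Gx /h0 patchE mem_set//= in_itv/= !ltW.
have Gk y : a <= y -> y <= b -> \int[mu]_(t in `[a, y]) h0 t = k y - k a.
  move=> ay yb; rewrite FTC//; apply: eq_Rintegral => t; rewrite inE/= in_itv/= => /andP[at_ ty].
  by rewrite /h0 patchE mem_set//= in_itv/= at_ (le_trans ty).
apply/is_deriv_onP => e e0; have [d d0 dP] := derivable_slope dG Gx e0.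
exists d => // y ay yb yxd; have := dP _ yxd.
by rewrite !Gk//; [rewrite opprB addrA subrK|exact: ltW..].
Qed.

End abs_continuous_integral.

End abs_continuity.

(** * Powers and the beta integral *)

Section continuous_integrals.
Context {R : realType}.
Notation mu := (@lebesgue_measure R).
Implicit Types f F : R -> R.

Lemma continuous_integrable_segment f (a b : R) : continuous f ->
  mu.-integrable `[a, b] (EFin \o f).
Proof.
move=> cf; apply: continuous_compact_integrable; first exact: segment_compact.
exact: continuous_subspaceT.
Qed.

Lemma is_derive_continuous F (x l : R) : is_derive x 1 F l -> {for x, continuous F}.
Proof. by move=> dF; apply: differentiable_continuous; apply/derivable1_diffP; exact: ex_derive. Qed.

Lemma Rintegral_derive f F (a b : R) : a <= b -> continuous f ->
  (forall x, a <= x -> x <= b -> is_derive x 1 F (f x)) ->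
  \int[mu]_(x in `[a, b]) f x = F b - F a.
Proof.
rewrite le_eqVlt => /predU1P[<- _ _|ab cf dF].
  by rewrite set_itv1 Rintegral_set1 subrr.
rewrite /Rintegral (@continuous_FTC2 _ f F)//.
- exact: continuous_subspaceT.
- split.
  + by move=> x; rewrite in_itv/= => /andP[ax xb]; have := dF _ (ltW ax) (ltW xb) => -[].
  + apply: cvg_at_right_filter; apply: is_derive_continuous.
    by apply: dF => //; exact: ltW.
  + apply: cvg_at_left_filter; apply: is_derive_continuous.
    by apply: dF => //; exact: ltW.
- move=> x; rewrite in_itv/= => /andP[ax xb]; have := dF _ (ltW ax) (ltW xb) => dFx.
  by rewrite derive1E derive_val.
Qed.

Lemma continuous_primitive f (A B : R) : A < B ->
  (forall x, A < x -> {for x, continuous f}) ->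
  exists F : R -> R, forall x, B < x -> is_derive x 1 F (f x).
Proof.
move=> AB cf; exists (fun x => \int[mu]_(t in `[B, x]) f t) => x Bx.
have [] := @continuous_FTC1_closed _ f B x (x + 1) _ _ Bx (cf x (lt_trans AB Bx)).
- by rewrite ltrDl.
- apply: continuous_compact_integrable; first exact: segment_compact.
  apply: continuous_in_subspaceT => t; rewrite inE/= in_itv/= => /andP[Bt _].
  exact/cf/(lt_le_trans AB).
by move=> dF; rewrite derive1E => <-; exact: derivableP.
Qed.

Lemma Rintegral_gt0 f (a b : R) : a < b -> continuous f ->
  (forall x, a <= x -> x <= b -> 0 <= f x) ->
  (exists x, [/\ a < x, x < b & 0 < f x]) -> 0 < \int[mu]_(x in `[a, b]) f x.
Proof.
move=> ab cf f0 [x [ax xb fx]].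
have fx2 : f x / 2 < f x by lra.
have := cvgr_gt _ (cf x) _ fx2 => /= -[d /= d0 dP].
pose m := Num.min d (Num.min (x - a) (b - x)) / 2.
have m0 : 0 < Num.min d (Num.min (x - a) (b - x)) by rewrite !lt_min d0 !subr_gt0 ax xb.
have : m < Num.min d (Num.min (x - a) (b - x)) by rewrite /m; lra.
rewrite !lt_min => /and3P[md mxa mbx].
have m0' : 0 < m by rewrite divr_gt0.
apply: (@lt_le_trans _ _ (\int[mu]_(t in `[x - m, x + m]) (f x / 2))).
  rewrite Rintegral_cst//= lebesgue_measure_itv/= lte_fin.
  have -> : (x - m < x + m) = true by lra.
  by rewrite -EFinB/=; apply: mulr_gt0; lra.
apply: (@le_trans _ _ (\int[mu]_(t in `[x - m, x + m]) f t)).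
  apply: le_Rintegral => //.
  - by apply: (@continuous_integrable_segment (cst (f x / 2))); exact: cst_continuous.
  - exact: continuous_integrable_segment.
  - move=> t /=; rewrite in_itv/= => /andP[h1 h2]; apply/ltW/dP.
    by rewrite /ball_/= ltr_norml; apply/andP; split; lra.
apply: fine_le.
- by apply: integrable_fin_num => //; exact: continuous_integrable_segment.
- by apply: integrable_fin_num => //; exact: continuous_integrable_segment.
apply: ge0_subset_integral => //.
- exact: (measurable_int _ (continuous_integrable_segment _ _ cf)).
- by move=> t /=; rewrite in_itv/= => /andP[? ?]; rewrite lee_fin f0.
- by apply: subset_itv; rewrite bnd_simp; lra.
Qed.

End continuous_integrals.

(** * Signed powers and the strict convexity of |x|^q *)

Section signed_power.
Context {R : realType}.
Implicit Types (r q x y : R).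

(** For r = q - 1 > 0 this is the derivative of |x|^q divided by q. Composed with phi it gives both
    the first order conditions and the extremal f''. *)
Definition sgpowR r x : R := Num.sg x * `|x| `^ r.

Lemma sgpowRE r x : 0 <= x -> 0 < r -> sgpowR r x = x `^ r.
Proof.
rewrite le_eqVlt => /predU1P[<-|x0] r0; last by rewrite /sgpowR gtr0_sg// mul1r gtr0_norm.
by rewrite /sgpowR sgr0 mul0r powR0// gt_eqF.
Qed.

Lemma sgpowRN r x : sgpowR r (- x) = - sgpowR r x.
Proof. by rewrite /sgpowR sgrN mulNr normrN. Qed.

Lemma sgpowRM r k x : 0 < k -> sgpowR r (k * x) = k `^ r * sgpowR r x.
Proof.
move=> k0; rewrite /sgpowR sgrM normrM gtr0_sg// mul1r (gtr0_norm k0).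
by rewrite powRM ?normr_ge0 ?ltW// mulrCA.
Qed.

Lemma norm_sgpowR r x : 0 < r -> `|sgpowR r x| = `|x| `^ r.
Proof.
move=> r0; rewrite /sgpowR normrM (ger0_norm (powR_ge0 _ _)) normr_sg.
by case: eqVneq => [->|_] /=; rewrite ?mul1r// normr0 powR0 ?mulr0// gt_eqF.
Qed.

Lemma mul_sgpowR q x : 1 < q -> x * sgpowR (q - 1) x = `|x| `^ q.
Proof.
move=> q1; rewrite /sgpowR mulrA [x * _]mulrC -normrEsg mulr_powRB1//; lra.
Qed.

Lemma continuous_norm_powR r : 0 < r -> continuous (fun x => `|x| `^ r).
Proof.
move=> r0 x; have [->|x0] := eqVneq x 0.
  rewrite /continuous_at normr0 powR0 ?gt_eqF//.
  apply/cvgrPdist_lt => e e0; exists (e `^ r^-1); first exact: powR_gt0.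
  move=> y /=; rewrite sub0r normrN => ye; rewrite sub0r normrN ger0_norm ?powR_ge0//.
  have rn0 : r != 0 by rewrite gt_eqF.
  rewrite -[ltRHS]powRr1; last exact: ltW.
  rewrite -(mulVf rn0) powRrM.
  by rewrite gt0_ltr_powR ?nnegrE ?powR_ge0.
apply: (@cvg_comp _ _ _ (fun y : R => `|y|) (fun y : R => y `^ r) (nbhs x) (nbhs `|x|)).
  exact: norm_continuous.
have nx : 0 < `|x| by rewrite normr_gt0.
have cv : {for `|x|, continuous (fun y : R => y `^ r)}.
  apply: differentiable_continuous; apply/derivable1_diffP.
  by apply: derivable_powR; rewrite in_itv/= nx.
exact: cv.
Qed.

Lemma continuous_sgpowR r : 0 < r -> continuous (sgpowR r).
Proof.
move=> r0.
(* The two bases are the positive and negative parts of [x], both continuous, and one of them always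
   vanishes. *)
have -> : sgpowR r = (fun x => `|2^-1 * (`|x| + x)| `^ r - `|2^-1 * (`|x| - x)| `^ r).
  apply/funext => x; have [x0|x0] := leP 0 x.
    rewrite sgpowRE// (ger0_norm x0) subrr mulr0 normr0 [0 `^ _]powR0 ?gt_eqF// subr0.
    by have -> : 2^-1 * (x + x) = x; [lra|rewrite ger0_norm].
  rewrite (ltr0_norm x0) addNr mulr0 normr0 [0 `^ _]powR0 ?gt_eqF// sub0r.
  have -> : 2^-1 * (- x - x) = - x by lra.
  by rewrite normrN /sgpowR ltr0_sg// mulN1r.
move=> x; apply: cvgB.
  apply: (@cvg_comp _ _ _ (fun y : R => 2^-1 * (`|y| + y)) (fun y : R => `|y| `^ r)).
    by apply: cvgMr; apply: cvgD; [exact: norm_continuous|exact: cvg_id].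
  exact: continuous_norm_powR.
apply: (@cvg_comp _ _ _ (fun y : R => 2^-1 * (`|y| - y)) (fun y : R => `|y| `^ r)).
  by apply: cvgMr; apply: cvgB; [exact: norm_continuous|exact: cvg_id].
exact: continuous_norm_powR.
Qed.

Lemma ltr_sgpowR r x y : 0 < r -> x < y -> sgpowR r x < sgpowR r y.
Proof.
move=> r0 xy.
have pos (u v : R) : 0 <= u -> u < v -> sgpowR r u < sgpowR r v.
  move=> u0 uv; rewrite !sgpowRE//; last exact: ltW (le_lt_trans u0 uv).
  by rewrite gt0_ltr_powR// nnegrE// ltW// (le_lt_trans u0).
have [x0|x0] := leP 0 x; first exact: pos.
have [y0|y0] := leP y 0.
  by have := pos (- y) (- x); rewrite !sgpowRN oppr_ge0 !ltrN2; apply.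
apply: (@lt_trans _ _ 0).
  by rewrite -[x]opprK sgpowRN oppr_lt0 /sgpowR gtr0_sg ?oppr_gt0// mul1r powR_gt0//
    normr_gt0 oppr_eq0 lt_eqF.
by rewrite /sgpowR gtr0_sg// mul1r powR_gt0// normr_gt0 gt_eqF.
Qed.

Lemma is_derive_norm_powR q x : 1 < q ->
  is_derive x 1 (fun y => `|y| `^ q) (q * sgpowR (q - 1) x).
Proof.
move=> q1; have q0 : 0 < q by lra. have q10 : 0 < q - 1 by lra.
have pos (y : R) : 0 < y -> is_derive y 1 (fun y => `|y| `^ q) (q * sgpowR (q - 1) y).
  move=> y0; rewrite sgpowRE// ?ltW//.
  apply: (@near_eq_is_derive _ _ _ (fun y => y `^ q)) => //.
  - near=> z; rewrite gtr0_norm//; near: z; exact: lt_nbhsr.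
  - exact: is_derive1_powR.
have [x0|x0|->] := ltgtP x 0; [|exact: pos|].
- have := pos (- x); rewrite oppr_gt0 => /(_ x0) H.
  have -> : (fun y : R => `|y| `^ q) = (fun y : R => `|y| `^ q) \o -%R.
    by apply/funext => y /=; rewrite normrN.
  have dN : is_derive x 1 (-%R : R -> R) (-1) by exact: is_deriveN.
  have H2 := @is_derive1_comp R (fun y : R => `|y| `^ q) -%R x _ _ H dN.
  by apply: (is_derive_eq H2); rewrite sgpowRN; lra.
(* At 0 the difference quotient is [sgpowR (q - 1) h] itself, which tends to 0. *)
have Q : h^-1 *: (`|h *: 1 + 0 : R| `^ q - `|0 : R| `^ q) @[h --> 0^'] --> (q * sgpowR (q - 1) 0).
  have -> : q * sgpowR (q - 1) 0 = sgpowR (q - 1) 0 by rewrite sgpowRE// powR0 ?mulr0// gt_eqF.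
  have E : {near 0^', sgpowR (q - 1) =1 (fun h => h^-1 *: (`|h *: 1 + 0 : R| `^ q - `|0 : R| `^ q))}.
    near=> h; have h0 : h != 0 by near: h; exact: nbhs_dnbhs_neq.
    rewrite normr0 powR0 ?gt_eqF// subr0 addr0 /GRing.scale/= mulr1 -mul_sgpowR// mulrA.
    by rewrite mulVf// mul1r.
  apply: cvg_trans (near_eq_cvg E) _.
  by apply: cvg_within_filter; exact: continuous_sgpowR.
by split; [apply/cvg_ex; eexists; exact: Q|exact: cvg_lim Q].
Unshelve. all: by end_near. Qed.

(** Strict convexity as a strict tangent inequality: by the mean value theorem the increment is a
    derivative at an intermediate point, and the derivative is strictly increasing. *)
Lemma norm_powR_tangent q u v : 1 < q -> u != v ->
  `|v| `^ q + q * sgpowR (q - 1) v * (u - v) < `|u| `^ q.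
Proof.
move=> q1 uv; have q0 : 0 < q by lra. have q10 : 0 < q - 1 by lra.
have cont (a b : R) : {within `[a, b], continuous (fun y => `|y| `^ q)}.
  by apply: continuous_subspaceT; exact: continuous_norm_powR.
move: uv; rewrite neq_lt => /orP[uv|vu].
  have [c cuv E] := MVT uv (fun y _ => is_derive_norm_powR y q1) (cont u v).
  move: cuv; rewrite in_itv/= => /andP[uc cv].
  have : q * sgpowR (q - 1) c < q * sgpowR (q - 1) v by rewrite ltr_pM2l// ltr_sgpowR.
  rewrite -(ltr_pM2r (_ : 0 < v - u)) ?subr_gt0// -E; lra.
have [c cuv E] := MVT vu (fun y _ => is_derive_norm_powR y q1) (cont v u).
move: cuv; rewrite in_itv/= => /andP[vc cu].
have : q * sgpowR (q - 1) v < q * sgpowR (q - 1) c by rewrite ltr_pM2l// ltr_sgpowR.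
rewrite -(ltr_pM2r (_ : 0 < u - v)) ?subr_gt0// -E; lra.
Qed.

End signed_power.

(** * Euler's product formula and the two beta values *)

Section beta_integral.
Context {R : realType}.
Notation mu := (@lebesgue_measure R).

(** The image of Lebesgue measure under x -> r x + c, multiplied by r, gives half-open intervals
    their length, hence is Lebesgue measure. *)
Lemma ge0_integral_affine (f : R -> \bar R) (r c : R) : 0 < r ->
  measurable_fun setT f -> (forall x, 0 <= f x)%E ->
  (\int[mu]_x f x = r%:E * \int[mu]_x f (r * x + c)%R)%E.
Proof.
move=> r0 mf f0.
pose phi : measurableTypeR R -> measurableTypeR R := fun x => r * x + c.
have mphi : measurable_fun setT phi.
  by apply: measurable_funD => //; apply: measurable_funM.
pose r' := NngNum (ltW r0).
transitivity (r'%:num%:E * \int[mu]_(x in phi @^-1` setT) (f \o phi) x)%E; last first.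
  by rewrite preimage_setT.
rewrite -(ge0_integral_pushforward mphi mu)// -ge0_integral_mscale//.
apply: eq_measure_integral => A mA _.
apply: lebesgue_measure_unique => // _ [[x y] _ <-].
transitivity (r%:E * mu (phi @^-1` `]x, y]%classic))%E; last by [].
have -> : phi @^-1` `]x, y] = `](x - c) / r, (y - c) / r]%classic.
  apply/seteqP; split => t /=; rewrite !in_itv/= /phi ltr_pdivrMr// ler_pdivlMr// [t * r]mulrC;
  by rewrite ltrBlDr lerBrDr.
rewrite !lebesgue_measure_itv/= !lte_fin ltr_pM2r ?invr_gt0// ltrD2r.
case: ifP => xy; last by rewrite mule0.
by rewrite -!EFinD -EFinM; congr EFin; field; rewrite gt_eqF.
Qed.

(* The cut-off makes the integrands total functions on the line: the library has
   [t `^ r = 1] for negative [t]. *)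
Definition pos_powR (r t : R) : R := if 0 < t then t `^ (r - 1) else 0.

Lemma pos_powR_ge0 r t : 0 <= pos_powR r t.
Proof. by rewrite /pos_powR; case: ifP => // _; exact: powR_ge0. Qed.

Lemma measurable_pos_powR r : measurable_fun setT (pos_powR r).
Proof.
apply: measurable_fun_ifT => //.
by apply: measurable_fun_ltr.
Qed.

Lemma pos_powRM r u t : 0 < u -> pos_powR r (u * t) = u `^ (r - 1) * pos_powR r t.
Proof.
move=> u0; rewrite /pos_powR pmulr_rgt0//; case: ifP => t0; last by rewrite mulr0.
by rewrite powRM// ltW.
Qed.

(** Extended real values let Tonelli's theorem prove the product formula before any finiteness is
    known. *)
Definition egamma (r : R) : \bar R := \int[mu]_t (pos_powR r t * expR (- t))%:E.

Definition ebeta (x y : R) : \bar R := \int[mu]_t (pos_powR x t * pos_powR y (1 - t))%:E.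

Lemma egamma_ge0 r : (0 <= egamma r)%E.
Proof. by apply: integral_ge0 => t _; rewrite lee_fin mulr_ge0 ?pos_powR_ge0 ?expR_ge0. Qed.

Lemma ebeta_ge0 x y : (0 <= ebeta x y)%E.
Proof. by apply: integral_ge0 => t _; rewrite lee_fin mulr_ge0 ?pos_powR_ge0. Qed.

Lemma measurable_pos_powR_expR r :
  measurable_fun setT (fun t => pos_powR r t * expR (- t)).
Proof.
apply: measurable_funM; first exact: measurable_pos_powR.
by apply: measurableT_comp => //; exact: measurableT_comp.
Qed.

Lemma measurable_egamma r :
  measurable_fun setT (fun t => (pos_powR r t * expR (- t))%:E).
Proof. by apply/measurable_EFinP; exact: measurable_pos_powR_expR. Qed.

Lemma measurable_beta_integrand x y :
  measurable_fun setT (fun t => pos_powR x t * pos_powR y (1 - t)).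
Proof.
apply: measurable_funM; first exact: measurable_pos_powR.
apply: measurableT_comp; first exact: measurable_pos_powR.
exact: measurable_funB.
Qed.

Lemma measurable_ebeta x y :
  measurable_fun setT (fun t => (pos_powR x t * pos_powR y (1 - t))%:E).
Proof. by apply/measurable_EFinP; exact: measurable_beta_integrand. Qed.

(* Both sides are iterated integrals of [s^(x-1) (u-s)^(y-1) exp(-u)] over
   [0 < s < u]; substitute [u = s + t] on the left and [s = u v] on the right. *)
Lemma egammaM x y : (egamma x * egamma y = egamma (x + y) * ebeta x y)%E.
Proof.
pose F s u : R := pos_powR x s * pos_powR y (u - s) * expR (- u).
have F0 s u : 0 <= F s u by rewrite !mulr_ge0 ?pos_powR_ge0 ?expR_ge0.
have mF : measurable_fun setT (fun z : R * R => F z.1 z.2).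
  apply: measurable_funM; first apply: measurable_funM.
  - by apply: measurableT_comp; [exact: measurable_pos_powR|exact: measurable_fst].
  - apply: measurableT_comp; first exact: measurable_pos_powR.
    by apply: measurable_funB; [exact: measurable_snd|exact: measurable_fst].
  - apply: measurableT_comp => //; apply: measurableT_comp => //.
transitivity (\int[mu]_s \int[mu]_u (F s u)%:E)%E.
  rewrite {1}/egamma -ge0_integralZr//; last 3 first.
  - exact: measurable_egamma.
  - by move=> t _; rewrite lee_fin mulr_ge0 ?pos_powR_ge0 ?expR_ge0.
  - exact: egamma_ge0.
  apply: eq_integral => s _.
  rewrite /egamma -ge0_integralZl//; last 3 first.
  - exact: measurable_egamma.
  - by move=> t _; rewrite lee_fin mulr_ge0 ?pos_powR_ge0 ?expR_ge0.
  - by rewrite lee_fin mulr_ge0 ?pos_powR_ge0 ?expR_ge0.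
  rewrite [LHS](@ge0_integral_affine _ 1 (- s))// ?mul1e; last 2 first.
  - apply: emeasurable_funM => //.
    exact: measurable_egamma.
  - by move=> t; rewrite mule_ge0// lee_fin mulr_ge0 ?pos_powR_ge0 ?expR_ge0.
  apply: eq_integral => u _; rewrite -EFinM mul1r; congr EFin.
  rewrite /F; have -> : expR (- u) = expR (- s) * expR (- (u - s)).
    by rewrite -expRD; congr expR; ring.
  ring.
have mF' : measurable_fun setT (fun z : R * R => (F z.1 z.2)%:E) by exact/measurable_EFinP.
rewrite (@fubini_tonelli _ _ _ _ _ mu mu (fun z => (F z.1 z.2)%:E))//=; last first.
  by move=> z; rewrite lee_fin.
rewrite {1}/egamma -ge0_integralZr//; last 3 first.
- exact: measurable_egamma.
- by move=> t _; rewrite lee_fin mulr_ge0 ?pos_powR_ge0 ?expR_ge0.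
- exact: ebeta_ge0.
apply: eq_integral => u _.
have [u0|u0] := ltP 0 u; last first.
  rewrite {1}/pos_powR ltNge u0/= mul0r mul0e; apply: integral0_eq => s _.
  rewrite /F /pos_powR; case: ifP => s0; last by rewrite !mul0r.
  by case: ifP => us0; [exfalso; lra|rewrite mulr0 mul0r].
rewrite [LHS](@ge0_integral_affine _ u 0)//; last 2 first.
- apply/measurable_EFinP; apply: measurable_funM => //; apply: measurable_funM.
    exact: measurable_pos_powR.
  apply: measurableT_comp; first exact: measurable_pos_powR.
  exact: measurable_funB.
- by move=> s; rewrite lee_fin.
rewrite /ebeta -ge0_integralZl//; last 3 first.
- apply/measurable_EFinP; apply: measurable_funM => //; apply: measurable_funM.
    by apply: measurableT_comp; [exact: measurable_pos_powR|exact: measurable_funD].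
  apply: measurableT_comp; first exact: measurable_pos_powR.
  by apply: measurable_funB => //; exact: measurable_funD.
- by move=> s _; rewrite lee_fin.
- by rewrite lee_fin ltW.
rewrite -ge0_integralZl//; last 3 first.
- exact: measurable_ebeta.
- by move=> t _; rewrite lee_fin mulr_ge0 ?pos_powR_ge0.
- by rewrite lee_fin mulr_ge0 ?pos_powR_ge0 ?expR_ge0.
apply: eq_integral => v _; rewrite -!EFinM; congr EFin.
rewrite /F addr0 -[X in X - u * v]mulr1 -mulrBr !pos_powRM//.
have -> : pos_powR (x + y) u = u `^ (x + y - 1) by rewrite /pos_powR u0.
have -> : u `^ (x + y - 1) = u * u `^ (x - 1) * u `^ (y - 1).
  have un0 : u != 0 by rewrite gt_eqF.
  have -> : x + y - 1 = 1 + (x - 1) + (y - 1) by ring.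
  rewrite (@powRD _ u (1 + (x - 1)) (y - 1)) ?un0 ?implybT//.
  by rewrite (@powRD _ u 1 (x - 1)) ?un0 ?implybT// powRr1// ltW.
ring.
Qed.

Lemma Gamma_fun_egamma r : Gamma_fun r = fine (egamma r).
Proof.
rewrite /Gamma_fun Rintegral_mkcond /Rintegral /egamma; congr fine.
apply: eq_integral => t _; congr EFin; rewrite patchE /pos_powR.
by rewrite mem_setE/= in_itv/= andbT; case: ifP => //; rewrite mul0r.
Qed.

(** [fine] sends +oo to 0, and a product with an infinite factor is 0 or +oo, so both sides vanish
    in the infinite cases. *)
Lemma ge0_fineM (x y : \bar R) : (0 <= x)%E -> (0 <= y)%E ->
  fine (x * y)%E = fine x * fine y.
Proof.
case: x => [x| |]; case: y => [y| |] //=; rewrite ?mulr0 ?mul0r ?lee_fin//.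
- by rewrite le_eqVlt => /predU1P[<-|x0] _; rewrite ?mul0e// gt0_muley.
- by move=> _; rewrite le_eqVlt => /predU1P[<-|y0]; rewrite ?mule0// gt0_mulye.
Qed.

(** On [1, 2] the power is at least the smaller of its end values, whatever the sign of r - 1, and
    exp(-t) is at least exp(-2). *)
Lemma egamma_gt0 r : (0 < egamma r)%E.
Proof.
apply: (@lt_le_trans _ _ (\int[mu]_(t in `[1%R, 2%R]) (Num.min 1 (2 `^ (r - 1)) * expR (- 2))%:E)%E).
  rewrite integral_cst//= lebesgue_measure_itv/= lte_fin ltr1n -EFinB -EFinM lte_fin.
  by rewrite !mulr_gt0 ?expR_gt0 ?lt_min ?ltr01 ?powR_gt0//; lra.
apply: (@le_trans _ _ (\int[mu]_(t in `[1%R, 2%R]) (pos_powR r t * expR (- t))%:E)%E).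
  apply: ge0_le_integral => //.
  - by apply: measurable_funTS; exact: measurable_egamma.
  - move=> t /=; rewrite in_itv/= => /andP[t1 t2]; rewrite lee_fin.
    have t0 : 0 < t by apply: lt_le_trans t1.
    rewrite ler_pM ?expR_ge0 ?ler_expR ?lerN2// /pos_powR ?t0.
    rewrite ge_min; have [r1|r1] := leP 0 (r - 1).
      have : 1 `^ (r - 1) <= t `^ (r - 1) by apply: ge0_ler_powR; rewrite ?nnegrE//; exact: ltW.
      by rewrite powR1 => ->.
    apply/orP; right; have -> : r - 1 = - (1 - r) by ring.
    rewrite !powRN lef_pV2 ?posrE ?powR_gt0//.
    by apply: ge0_ler_powR; rewrite ?nnegrE//; lra.
apply: ge0_subset_integral => //.
  exact: measurable_egamma.
by move=> t _; rewrite lee_fin mulr_ge0 ?pos_powR_ge0 ?expR_ge0.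
Qed.

(** From ln (t / k) <= t / k - 1 with k = 2 (r - 1) one gets t^(r-1) exp(-t) <= k^(r-1) exp(-t/2), a
    multiple of the exponential density of rate 1/2. *)
Lemma egamma_lty r : 1 < r -> (egamma r < +oo)%E.
Proof.
move=> r1; have r10 : 0 < r - 1 by rewrite subr_gt0.
pose k := 2 * (r - 1); have k0 : 0 < k by rewrite mulr_gt0.
pose C := 2 * expR ((r - 1) * ln k).
have C0 : 0 <= C by rewrite mulr_ge0 ?expR_ge0.
apply: (@le_lt_trans _ _ (\int[mu]_t (C%:E * (exponential_pdf (2^-1) t)%:E))%E).
  apply: ge0_le_integral => //.
  - by move=> t _; rewrite lee_fin mulr_ge0 ?pos_powR_ge0 ?expR_ge0.
  - exact: measurable_egamma.
  - apply: emeasurable_funM => //; apply/measurable_EFinP; exact: measurable_exponential_pdf.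
  - move=> t _; rewrite -EFinM lee_fin /pos_powR; case: ifP => t0; last first.
      by rewrite mul0r mulr_ge0// exponential_pdf_ge0.
    rewrite exponential_pdfE; last exact: ltW.
    rewrite /C.
    have -> : 2 * expR ((r - 1) * ln k) * (2^-1 * expR (- 2^-1 * t)) =
       expR ((r - 1) * ln k - 2^-1 * t).
      by rewrite expRD mulNr; field.
    rewrite /powR gt_eqF// -expRD ler_expR.
    have : ln (1 + (t / k - 1)) <= t / k - 1.
      by apply: le_ln1Dx; rewrite ltrBrDr addNr divr_gt0.
    rewrite addrC subrK ln_div ?posrE// => H.
    have H' : (r - 1) * (ln t - ln k) <= (r - 1) * (t / k - 1) by rewrite ler_pM2l.
    have E : (r - 1) * (t / k) = 2^-1 * t by rewrite /k; field; rewrite gt_eqF.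
    move: H'; rewrite !mulrBr E; lra.
rewrite ge0_integralZl//.
- by rewrite integral_exponential_pdf// mule1 ltry.
- apply/measurable_EFinP; exact: measurable_exponential_pdf.
- by move=> t _; rewrite lee_fin exponential_pdf_ge0.
Qed.

Lemma Beta_funC (x y : R) : Beta_fun x y = Beta_fun y x.
Proof. by rewrite /Beta_fun (addrC y) (mulrC (Gamma_fun y)). Qed.

(** Only the Gamma value at [x + y] is cancelled, so only it has to be finite and positive; this
    covers [x = 1/2]. *)
Lemma Beta_fun_ebeta x y : 1 < x + y -> Beta_fun x y = fine (ebeta x y).
Proof.
move=> xy; rewrite /Beta_fun !Gamma_fun_egamma -ge0_fineM ?egamma_ge0// egammaM.
rewrite ge0_fineM ?egamma_ge0 ?ebeta_ge0// mulrAC divff ?mul1r//.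
by rewrite gt_eqF// fine_gt0// egamma_gt0 egamma_lty.
Qed.

(** Substitute on the compact intervals [1/(n+1), n+1], where the square is increasing and [G] is
    continuous on the image, then let n grow by monotone convergence. *)
Lemma ge0_integral_sqr (G : R -> R) : (forall x, 0 <= G x) ->
  {in `]0, +oo[, continuous G} ->
  (\int[mu]_(x in `]0%R, +oo[) (G x)%:E =
   \int[mu]_(x in `]0%R, +oo[) (G (x ^+ 2) * (2 * x))%:E)%E.
Proof.
move=> G0 cG.
pose e n : R := n.+1%:R^-1; pose E n : R := n.+1%:R.
have e0 n : 0 < e n by rewrite invr_gt0.
have eE n : e n <= E n.
  by rewrite /e /E (@le_trans _ _ 1)// ?invf_le1// ler1n.
have en m n : (m <= n)%N -> e n <= e m by move=> mn; rewrite lef_pV2 ?posrE// ler_nat.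
have En m n : (m <= n)%N -> E m <= E n by move=> mn; rewrite ler_nat.
pose A n := `[e n, E n]%classic : set R; pose B n := `[e n ^+ 2, E n ^+ 2]%classic : set R.
have AT : \bigcup_n A n = `]0, +oo[%classic.
  apply/seteqP; split => x.
    by move=> [n _]; rewrite /A /= !in_itv/= andbT => /andP[/(lt_le_trans (e0 n))].
  rewrite /= in_itv/= andbT => x0.
  exists (maxn (Num.trunc x) (Num.trunc x^-1)) => //; rewrite /A/= in_itv/=; apply/andP; split.
    rewrite invf_ple ?posrE//; apply: le_trans (ltW (truncnS_gt _)) _.
    by rewrite ler_nat ltnS leq_maxr.
  by apply: le_trans (ltW (truncnS_gt _)) _; rewrite ler_nat ltnS leq_maxl.
have BT : \bigcup_n B n = `]0, +oo[%classic.
  apply/seteqP; split => x.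
    by move=> [n _]; rewrite /B /= !in_itv/= andbT => /andP[+ _]; apply: lt_le_trans; rewrite exprn_gt0.
  rewrite /= in_itv/= andbT => x0.
  have sx0 : 0 < Num.sqrt x by rewrite sqrtr_gt0.
  have : (\bigcup_n A n) (Num.sqrt x) by rewrite AT/= in_itv/= sx0.
  move=> [n _]; rewrite /A/= in_itv/= => /andP[h1 h2]; exists n => //.
  rewrite /B/= in_itv/= -(sqr_sqrtr (ltW x0)) !ler_sqr ?nnegrE ?h1 ?h2//; exact: ltW.
have mG : measurable_fun (`]0, +oo[%classic : set R) G.
  by apply: open_continuous_measurable_fun => //; move=> x; rewrite inE; exact: cG.
have msq : measurable_fun (`]0, +oo[%classic : set R) (fun x => G (x ^+ 2) * (2 * x)).
  apply: open_continuous_measurable_fun => // x; rewrite inE/= in_itv/= andbT => x0.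
  apply: cvgM; last by apply: cvgMr; exact: cvg_id.
  apply: (@cvg_comp _ _ _ (fun y : R => y ^+ 2) G); last first.
    by apply: cG; rewrite in_itv/= andbT exprn_gt0.
  exact: exprn_continuous.
have AS n : A n `<=` (`]0, +oo[%classic : set R) by move=> x Ax; rewrite -AT; exists n.
have BS n : B n `<=` (`]0, +oo[%classic : set R) by move=> x Bx; rewrite -BT; exists n.
have lA : (\int[mu]_(x in A n) (G (x ^+ 2) * (2 * x))%:E @[n --> \oo] -->
   \int[mu]_(x in \bigcup_n A n) (G (x ^+ 2) * (2 * x))%:E)%E.
  apply: ge0_nondecreasing_set_cvg_integral => //.
  - move=> m n mn; apply/subsetPset => x; rewrite /A/= !in_itv/= => /andP[h1 h2].
    by rewrite (le_trans (en _ _ mn))// (le_trans h2)// En.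
  - by move=> n; exact: measurable_itv.
  - by move=> n; apply/measurable_EFinP; exact: measurable_funS (AS n) msq.
  - move=> n x /AS; rewrite /= in_itv/= andbT => x0.
    by rewrite lee_fin !mulr_ge0// ltW.
have lB : (\int[mu]_(x in B n) (G x)%:E @[n --> \oo] -->
   \int[mu]_(x in \bigcup_n B n) (G x)%:E)%E.
  apply: ge0_nondecreasing_set_cvg_integral => //.
  - move=> m n mn; apply/subsetPset => x; rewrite /B/= !in_itv/= => /andP[h1 h2].
    apply/andP; split.
      by apply: le_trans h1; rewrite ler_sqr ?nnegrE; [exact: en|exact: ltW..].
    by apply: (le_trans h2); rewrite ler_sqr ?nnegrE//; exact: En.
  - by move=> n; exact: measurable_itv.
  - by move=> n; apply/measurable_EFinP; exact: measurable_funS (BS n) mG.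
  - by move=> n x _; rewrite lee_fin.
rewrite -{1}BT -AT.
have ABn n : (\int[mu]_(x in B n) (G x)%:E = \int[mu]_(x in A n) (G (x ^+ 2) * (2 * x))%:E)%E.
  have dsq (x : R) : is_derive x 1 (fun x : R => x ^+ 2) (2 * x).
    have -> : (fun x : R => x ^+ 2) = (fun x => x * x) by apply/funext => y; rewrite expr2.
    by apply: is_derive_eq; rewrite /GRing.scale/=; ring.
  have dsq1 : derive1 (fun x : R => x ^+ 2) = (fun x => 2 * x).
    by apply/funext => x; rewrite derive1E derive_val.
  have := @integration_by_substitution_increasing R (fun x => x ^+ 2) G (e n) (E n) (eE n).
  rewrite /A /B dsq1 => ->//.
  - move=> x y; rewrite !in_itv/= => /andP[ex _] /andP[ey _] xy.
    by rewrite ltr_sqr ?nnegrE// ltW// (lt_le_trans (e0 n)).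
  - by move=> x _; apply: cvgMr; exact: cvg_id.
  - by apply/cvg_ex; exists (2 * e n); apply: cvgMr; apply: cvg_at_right_filter; exact: cvg_id.
  - by apply/cvg_ex; exists (2 * E n); apply: cvgMr; apply: cvg_at_left_filter; exact: cvg_id.
  - split.
    + by move=> x _; exact: ex_derive.
    + by apply: cvg_at_right_filter; exact: exprn_continuous.
    + by apply: cvg_at_left_filter; exact: exprn_continuous.
  - apply: continuous_in_subspaceT => x; rewrite inE => /(BS n) x0; exact: cG.
by rewrite -(cvg_lim _ lB)// -(cvg_lim _ lA)//; congr (limn _); apply/funext => n; exact: ABn.
Qed.

Lemma continuous_pos_powR r : 1 < r -> continuous (pos_powR r).
Proof.
move=> r1; have r10 : 0 < r - 1 by lra.
have -> : pos_powR r = (fun x => `|2^-1 * (`|x| + x)| `^ (r - 1)).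
  apply/funext => x; rewrite /pos_powR; have [x0|x0] := ltP 0 x.
    rewrite (gtr0_norm x0); have -> : 2^-1 * (x + x) = x by lra.
    by rewrite gtr0_norm.
  by rewrite (ler0_norm x0) addNr mulr0 normr0 powR0// gt_eqF.
move=> x.
apply: (@cvg_comp _ _ _ (fun y : R => 2^-1 * (`|y| + y)) (fun y : R => `|y| `^ (r - 1))).
  by apply: cvgMr; apply: cvgD; [exact: norm_continuous|exact: cvg_id].
exact: continuous_norm_powR.
Qed.

Variable q : R.
Hypothesis q1 : 1 < q.

Let k s := pos_powR q (1 - s ^+ 2).

Let k0 s : 0 <= k s. Proof. exact: pos_powR_ge0. Qed.

Let ck : continuous k.
Proof.
move=> s; apply: (@cvg_comp _ _ _ (fun y : R => 1 - y ^+ 2) (pos_powR q)).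
  by apply: cvgB; [exact: cvg_cst|exact: exprn_continuous].
exact: continuous_pos_powR.
Qed.

Let J := \int[mu]_(s in `[0, 1]) (1 - s ^+ 2) `^ (q - 1).

Let JE : (\int[mu]_(s in `]0%R, +oo[) (k s)%:E = J%:E)%E.
Proof.
have -> : J = \int[mu]_(s in `[0, 1]) k s.
  apply: eq_Rintegral => s; rewrite inE/= in_itv/= => /andP[s0 s1].
  rewrite /k /pos_powR; case: ltP => // s2.
  have s2' : 1 - s ^+ 2 = 0.
    by apply/eqP; rewrite eq_le s2/= subr_ge0 expr_le1.
  by rewrite s2' powR0// gt_eqF// subr_gt0.
rewrite /Rintegral fineK; last first.
  by apply: integrable_fin_num => //; exact: continuous_integrable_segment.
rewrite -integral_itv_obnd_cbnd; last first.
  by apply/measurable_EFinP; apply: measurable_funTS; exact: continuous_measurable_fun.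
rewrite integral_mkcond [RHS]integral_mkcond; apply: eq_integral => s _.
rewrite !patchE !mem_setE/= !in_itv/= andbT; case: ltP => //= s0.
case: leP => // s1; rewrite /k /pos_powR ltNge.
by have -> : 1 - s ^+ 2 <= 0; rewrite // subr_le0 exprn_ege1// ltW.
Qed.

(* Substitute [v = s^2]. *)
Let ebeta_half : ebeta 2^-1 q = (2 * J)%:E.
Proof.
pose G v : R := pos_powR 2^-1 v * pos_powR q (1 - v).
have -> : (ebeta 2^-1 q = \int[mu]_(v in `]0%R, +oo[) (G v)%:E)%E.
  rewrite /ebeta [RHS]integral_mkcond; apply: eq_integral => v _.
  rewrite patchE mem_setE/= in_itv/= andbT; case: ifPn => // v0.
  by rewrite /pos_powR (negbTE v0) mul0r.
rewrite ge0_integral_sqr.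
- rewrite EFinM -JE -ge0_integralZl//; last 2 first.
  + by apply/measurable_EFinP; apply: measurable_funTS; exact: continuous_measurable_fun.
  + by move=> s _; rewrite lee_fin.
  apply: eq_integral => s; rewrite inE/= in_itv/= andbT => s0.
  rewrite -EFinM; congr EFin; rewrite /G /k {1}/pos_powR exprn_gt0//.
  (* (s^2)^(-1/2) = 1/s cancels the s of the Jacobian 2 s. *)
  rewrite -powR_mulrn ?ltW// -powRrM.
  have -> : 2%:R * (2^-1 - 1) = -1 :> R by lra.
  rewrite powR_inv1 ?ltW//; field; by rewrite gt_eqF.
- by move=> v; rewrite mulr_ge0 ?pos_powR_ge0.
- move=> v; rewrite in_itv/= andbT => v0; rewrite /G; apply: cvgM; last first.
    apply: (@cvg_comp _ _ _ (fun y : R => 1 - y) (pos_powR q)).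
      by apply: cvgB; [exact: cvg_cst|exact: cvg_id].
    exact: continuous_pos_powR.
  have E : {near v, (fun y => y `^ (2^-1 - 1)) =1 pos_powR 2^-1}.
    near=> y; rewrite /pos_powR; have -> // : 0 < y.
    by near: y; exact: lt_nbhsr.
  rewrite {2}/pos_powR v0; apply: cvg_trans (near_eq_cvg E) _.
  have cv : {for v, continuous (fun y : R => y `^ (2^-1 - 1))}.
    apply: differentiable_continuous; apply/derivable1_diffP.
    by apply: derivable_powR; rewrite in_itv/= v0.
  exact: cv.
Unshelve. all: by end_near. Qed.

(* Substitute [v = (1 + s) / 2]. *)
Let ebeta_diag : ebeta q q = (2 `^ (2 - 2 * q) * J)%:E.
Proof.
rewrite /ebeta (@ge0_integral_affine _ 2^-1 2^-1)//; last 2 first.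
- exact: measurable_ebeta.
- by move=> v; rewrite lee_fin mulr_ge0 ?pos_powR_ge0.
have E (s : R) : (pos_powR q (2^-1 * s + 2^-1) * pos_powR q (1 - (2^-1 * s + 2^-1)))%:E =
    ((2 `^ (2 - 2 * q))%:E * (k s)%:E)%E.
  rewrite -EFinM; congr EFin.
  have -> : 2^-1 * s + 2^-1 = 2^-1 * (1 + s) by ring.
  have -> : 1 - 2^-1 * (1 + s) = 2^-1 * (1 - s) by field.
  rewrite !pos_powRM ?invr_gt0// mulrACA; congr (_ * _).
    rewrite -powR_inv1// -!powRrM -powRD ?pnatr_eq0 ?implybT//; congr (_ `^ _); lra.
  rewrite /k /pos_powR.
  have -> : 1 - s ^+ 2 = (1 + s) * (1 - s) by ring.
  have [h1|h1] := ltP 0 (1 + s); have [h2|h2] := ltP 0 (1 - s).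
  - by rewrite mulr_gt0// powRM// ltW.
  - by rewrite ltNge mulr_ge0_le0 ?mulr0// ltW.
  - by rewrite ltNge mulr_le0_ge0 ?mul0r// ltW.
  - by exfalso; lra.
under eq_integral do rewrite E.
rewrite ge0_integralZl//; last 2 first.
- by apply/measurable_EFinP; exact: continuous_measurable_fun.
- by move=> s _; rewrite lee_fin.
(* The integrand is even; the factor 2 from halving the line cancels the Jacobian 1/2. *)
rewrite ge0_symfun_integralT//; last by move=> s /=; rewrite /k sqrrN.
have -> : [set x : R | 0 <= x] = `[0, +oo[%classic.
  by apply/seteqP; split => x /=; rewrite in_itv/= andbT.
rewrite -integral_itv_obnd_cbnd; last first.
  by apply/measurable_EFinP; apply: measurable_funTS; exact: continuous_measurable_fun.
by rewrite JE -!EFinM; congr EFin; field.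
Qed.

Lemma Beta_fun_half : 2^-1 * Beta_fun q 2^-1 =
  \int[mu]_(s in `[0, 1]) (1 - s ^+ 2) `^ (q - 1).
Proof.
rewrite Beta_funC Beta_fun_ebeta; last by rewrite ltr_wpDl.
by rewrite ebeta_half/= -/J mulrA mulVf// mul1r.
Qed.

Lemma Beta_fun_diag : 2 `^ (2 * q - 2) * Beta_fun q q =
  \int[mu]_(s in `[0, 1]) (1 - s ^+ 2) `^ (q - 1).
Proof.
rewrite Beta_fun_ebeta; last by rewrite (lt_trans q1)// ltrDl (lt_trans ltr01).
rewrite ebeta_diag/= -/J mulrA -powRD ?pnatr_eq0 ?implybT//.
have -> : 2 * q - 2 + (2 - 2 * q) = 0 :> R by ring.
by rewrite powRr0 mul1r.
Qed.

End beta_integral.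

(** * The error functional and its extremals *)

Section error_functional.
Context {R : realType}.
Notation mu := (@lebesgue_measure R).
Variables a b : R.
Hypothesis ab : a < b.
Implicit Types (f g k m : R -> R) (phi : {poly R}).

Lemma is_deriv_on_eq f g x l : a <= x -> x <= b ->
  (forall y, a <= y -> y <= b -> f y = g y) -> is_deriv_on a b f x l -> is_deriv_on a b g x l.
Proof.
move=> ax xb fg /is_deriv_onP H; apply/is_deriv_onP => e e0.
have [d d0 dP] := H e e0; exists d => // y ay yb yxd.
by rewrite -!fg//; exact: dP.
Qed.

Lemma abs_continuous_on_eq f g : (forall y, a <= y -> y <= b -> f y = g y) ->
  abs_continuous_on a b f -> abs_continuous_on a b g.
Proof.
move=> fg acf e e0; have [d d0 dP] := acf e e0; exists d => // n u v uv tI uvd.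
rewrite (eq_bigr (fun i => `|f (v i) - f (u i)|)); first exact: dP.
by move=> i _; have [au le_uv vb] := uv i; rewrite !fg ?(le_trans au le_uv) ?(le_trans le_uv vb).
Qed.

Lemma lipschitz_abs_continuous f M : 0 <= M ->
  (forall x y, a <= x -> x <= y -> y <= b -> `|f y - f x| <= M * (y - x)) ->
  abs_continuous_on a b f.
Proof.
move=> M0 fM e e0; exists (e / (M + 1)); first by rewrite divr_gt0// ltr_wpDl.
move=> n u v uv tI uvd.
apply: (@le_lt_trans _ _ (M * \sum_(i < n) (v i - u i))).
  by rewrite mulr_sumr; apply: ler_sum => i _; have [? ? ?] := uv i; exact: fM.
have s0 : 0 <= \sum_(i < n) (v i - u i).
  by apply: sumr_ge0 => i _; have [_ ? _] := uv i; rewrite subr_ge0.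
apply: (@le_lt_trans _ _ ((M + 1) * \sum_(i < n) (v i - u i))).
  by rewrite ler_wpM2r// lerDl.
by rewrite mulrC -ltr_pdivlMr// ltr_wpDl.
Qed.

(** In the split increment, the change of [k] is multiplied by at most [M], and the change of [m]
    contributes at most [K * L] times the length; each part gets [e / 2]. *)
Lemma abs_continuousM k m K L M : 0 <= K -> 0 <= L -> 0 <= M ->
  (forall x, a <= x -> x <= b -> `|k x| <= K) ->
  (forall x, a <= x -> x <= b -> `|m x| <= M) ->
  (forall x y, a <= x -> x <= y -> y <= b -> `|m y - m x| <= L * (y - x)) ->
  abs_continuous_on a b k -> abs_continuous_on a b (fun x => k x * m x).
Proof.
move=> K0 L0 M0 kK mM mL ack e e0.
have e20 : 0 < e / 2 by rewrite divr_gt0.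
have KL : 0 <= K * L by rewrite mulr_ge0.
have [d1 d10 d1P] := ack (e / 2 / (M + 1)) (divr_gt0 e20 (ltr_wpDl M0 ltr01)).
have acKL : abs_continuous_on a b (fun x => K * L * x).
  apply: (lipschitz_abs_continuous KL) => x y _ xy _.
  by rewrite -mulrBr normrM (ger0_norm KL) ger0_norm// subr_ge0.
have [d2 d20 d2P] := acKL _ e20.
exists (Num.min d1 d2); first by rewrite lt_min d10.
move=> n u v uv tI; rewrite lt_min => /andP[uvd1 uvd2].
have h1 := d1P n u v uv tI uvd1; have h2 := d2P n u v uv tI uvd2.
apply: (@le_lt_trans _ _ (\sum_(i < n) (M * `|k (v i) - k (u i)| + `|K * L * v i - K * L * u i|))).
  apply: ler_sum => i _; have [au le_uv vb] := uv i.
  have av := le_trans au le_uv; have ub := le_trans le_uv vb.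
  have -> : k (v i) * m (v i) - k (u i) * m (u i) =
    (k (v i) - k (u i)) * m (v i) + k (u i) * (m (v i) - m (u i)) by ring.
  apply: le_trans (ler_normD _ _) _; rewrite !normrM; apply: lerD.
    by rewrite mulrC ler_wpM2r// mM.
  rewrite -mulrBr normrM (ger0_norm KL) (ger0_norm (_ : 0 <= v i - u i)) ?subr_ge0//.
  by rewrite -mulrA ler_pM// ?kK ?mL.
rewrite big_split/= -mulr_sumr.
have h3 : M * \sum_(i < n) `|k (v i) - k (u i)| <= e / 2.
  apply: (@le_trans _ _ ((M + 1) * \sum_(i < n) `|k (v i) - k (u i)|)).
    by rewrite ler_wpM2r ?lerDl// sumr_ge0.
  by rewrite mulrC -ler_pdivlMr ?ltr_wpDl// ltW.
by apply: lt_le_trans (ler_ltD h3 h2) _; lra.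
Qed.

Lemma continuous_bounded_on f : {within `[a, b], continuous f} ->
  exists2 M, 0 <= M & forall x, a <= x -> x <= b -> `|f x| <= M.
Proof.
move=> cf; have [|c _ Hc] := @EVT_max R (fun x => `|f x|) a b (ltW ab).
  by move=> x; exact: (cvg_norm (cf x)).
by exists `|f c| => // x ax xb; apply: Hc; rewrite in_itv/= ax.
Qed.

Lemma derive_lipschitz f g : {within `[a, b], continuous g} ->
  (forall x, a <= x -> x <= b -> is_derive x 1 f (g x)) ->
  exists2 L, 0 <= L & forall x y, a <= x -> x <= y -> y <= b -> `|f y - f x| <= L * (y - x).
Proof.
move=> cg dfg; have [L L0 gL] := continuous_bounded_on cg; exists L => // x y ax xy yb.
have [||c] := @MVT_segment R f g x y xy.
- move=> z; rewrite in_itv/= => /andP[xz zy]; apply: dfg.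
    exact: le_trans ax (ltW xz).
  exact: le_trans (ltW zy) yb.
- apply: continuous_in_subspaceT => z; rewrite inE/= in_itv/= => /andP[xz zy].
  by apply: (@is_derive_continuous _ _ _ (g z)); apply: dfg; [exact: le_trans xz|exact: le_trans yb].
rewrite in_itv/= => /andP[xc cy] ->; rewrite normrM [X in _ * X]ger0_norm ?subr_ge0//.
by rewrite ler_wpM2r ?subr_ge0// gL//; [exact: le_trans xc|exact: le_trans yb].
Qed.

Lemma abs_continuous_within_continuous k : abs_continuous_on a b k ->
  {within `[a, b], continuous k}.
Proof.
move=> ack; have cK := abs_continuous_clamp_continuous (ltW ab) ack.
apply: (@subspace_eq_continuous _ _ _ (k \o clamp a b)); last exact: continuous_subspaceT.
by move=> x; rewrite inE/= in_itv/= => /andP[ax xb]; rewrite /from_subspace/= clamp_id.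
Qed.

Lemma is_deriv_on_LRcontinuous f g : (forall x, a <= x -> x <= b -> is_deriv_on a b f x (g x)) ->
  derivable_oo_LRcontinuous f a b.
Proof.
move=> dfg.
have near_ab (F : set_system R) x : is_deriv_on a b f x (g x) ->
  within `[a, b] (x^') `<=` F -> f y @[y --> F] --> f x.
  by move=> /is_deriv_on_cvg fx sF A Afx; apply: sF; exact: fx.
split.
- move=> x; rewrite in_itv/= => /andP[ax xb].
  by have [] := is_deriv_on_derive ax xb (dfg _ (ltW ax) (ltW xb)).
- apply: near_ab; first exact: dfg (lexx _) (ltW ab).
  move=> A [d /= d0 dA]; exists (Num.min d (b - a)); first by rewrite /= lt_min d0 subr_gt0.
  move=> y /=; rewrite lt_min => /andP[ayd ayb] ay.
  apply: dA => //=; first by rewrite gt_eqF.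
  rewrite in_itv/= ltW//=; move: ayb; rewrite ltr0_norm ?subr_lt0//; lra.
- apply: near_ab; first exact: dfg (ltW ab) (lexx _).
  move=> A [d /= d0 dA]; exists (Num.min d (b - a)); first by rewrite /= lt_min d0 subr_gt0.
  move=> y /=; rewrite lt_min => /andP[ayd ayb] yb.
  apply: dA => //=; first by rewrite lt_eqF.
  rewrite in_itv/= (ltW yb) andbT; move: ayb; rewrite gtr0_norm ?subr_gt0//; lra.
Qed.

Lemma monic_quadraticP phi : monic_quadratic phi ->
  exists u v, phi = 'X^2 + u *: 'X + v%:P.
Proof.
move=> [mphi sphi]; exists phi`_1, phi`_0.
move: mphi; rewrite monicE lead_coefE sphi/= => /eqP p2.
apply/polyP => i; rewrite !coefD coefZ coefXn coefX coefC.
case: i => [|[|[|i]]] /=; rewrite ?mulr0 ?mulr1 ?add0r ?addr0//.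
by rewrite nth_default// sphi.
Qed.

Lemma monic_quadratic_derivs phi : monic_quadratic phi -> phi^`()^`() = 2%:P.
Proof.
move=> [mphi sphi]; move: mphi; rewrite monicE lead_coefE sphi/= => /eqP p2.
apply/polyP => i; rewrite !coef_deriv coefC.
case: i => [|i]; first by rewrite p2.
by rewrite nth_default ?mul0rn// sphi.
Qed.

Lemma Lp_on_measurable p f : Lp_on a b p f -> measurable_fun `[a, b] f.
Proof.
rewrite /Lp_on inE => /andP[]; rewrite inE/= => mf _.
exact: (measurable_restrictT f (measurable_itv `[a, b])).2.
Qed.

Lemma admissible_is_deriv_on p f : admissible a b p f ->
  forall x, a <= x -> x <= b -> is_deriv_on a b f x (deriv_on a b f x).
Proof.
move=> [df _ _] x ax xb; have [|l fxl] := df x; first by rewrite in_itv/= ax.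
by rewrite (deriv_onE ab ax xb fxl).
Qed.

Lemma integrable_mul_continuous h m : mu.-integrable `[a, b] (EFin \o h) ->
  continuous m -> mu.-integrable `[a, b] (EFin \o (fun x => h x * m x)).
Proof.
move=> ih cm; have [M M0 mM] := continuous_bounded_on (continuous_subspaceT cm).
have := @integrableMl _ _ _ mu `[a, b]%classic (measurable_itv _) (EFin \o h) m ih.
apply; first by apply: measurable_funTS; exact: continuous_measurable_fun.
exists M; split; first exact: ger0_real.
move=> y My x /=; rewrite in_itv/= => /andP[ax xb].
exact: le_trans (mM x ax xb) (ltW My).
Qed.

(** f' phi is absolutely continuous with derivative f'' phi + f' phi' almost everywhere, so its
    increment is the integral of that sum. The term f' phi' then yields to ordinary integration by
    parts, as f' is continuous and phi'' = 2. *)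
Lemma quadrature_formula p phi f : monic_quadratic phi -> admissible a b p f ->
  \int[mu]_(x in `[a, b]) f x = quad_rule a b phi f + quad_error a b phi f.
Proof.
move=> mphi adm; have dfg := admissible_is_deriv_on adm.
have [_ acg Lpg] := adm.
set g := deriv_on a b f in dfg acg Lpg *.
have cgw := abs_continuous_within_continuous acg.
have [h [ih hE hae]] := abs_continuous_FTC ab acg.
have [G G0 gG] := continuous_bounded_on cgw.
have cphi := @continuous_horner _ phi.
have cdphi := @continuous_horner _ phi^`().
have [M M0 phiM] := continuous_bounded_on (continuous_subspaceT cphi).
have [L L0 phiL] := derive_lipschitz (continuous_subspaceT cdphi) (fun x _ _ => is_derive_poly phi x).
have ack := abs_continuousM G0 L0 M0 gG phiM phiL acg.
have [h1 [ih1 h1E h1ae]] := abs_continuous_FTC ab ack.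
pose gK := g \o clamp a b.
have cgK : continuous gK := abs_continuous_clamp_continuous (ltW ab) acg.
have gKE x : a <= x -> x <= b -> gK x = g x by move=> ax xb; rewrite /gK/= clamp_id.
have ihphi := integrable_mul_continuous ih cphi.
have igdphi : mu.-integrable `[a, b] (EFin \o (fun x => gK x * phi^`().[x])).
  by apply: integrable_mul_continuous => //; exact: continuous_integrable_segment.
(* The derivatives almost everywhere are given at interior points only, so both endpoints are
   discarded as a null set. *)
have eab : {ae mu, forall x, x <> a /\ x <> b}.
  exists ([set a] `|` [set b]); split.
  - exact: measurableU.
  - by apply: null_set_setU => //; exact: lebesgue_measure_set1.
  - move=> x /= H; apply: contrapT => /not_orP[xa xb]; exact: H.
have E1 : \int[mu]_(x in `[a, b]) (deriv_on a b g x * phi.[x]) =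
          \int[mu]_(x in `[a, b]) (h x * phi.[x]).
  rewrite /Rintegral; congr fine; apply: ae_eq_integral => //.
  - apply/measurable_EFinP; apply: measurable_funM; first exact: Lp_on_measurable Lpg.
    by apply: measurable_funTS; exact: continuous_measurable_fun.
  - exact: measurable_int ihphi.
  - have AE : {ae mu, forall x, `[a, b]%classic x ->
        (deriv_on a b g x * phi.[x])%:E = (h x * phi.[x])%:E}; last exact: AE.
    apply: filterS (@filterI _ _ (ae_filter_ringOfSetsType mu) _ _ hae eab)
      => x [hx [xa xb]] /=; rewrite in_itv/= => /andP[ax xb'].
    have ax' : a < x by rewrite lt_neqAle ax andbT eq_sym; exact/eqP.
    have xb'' : x < b by rewrite lt_neqAle xb' andbT; exact/eqP.
    by rewrite (deriv_onE ab ax xb' (hx ax' xb'')).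
have E2 : \int[mu]_(x in `[a, b]) h1 x =
    \int[mu]_(x in `[a, b]) (h x * phi.[x] + gK x * phi^`().[x]).
  rewrite /Rintegral; congr fine; apply: ae_eq_integral => //.
  - exact: measurable_int ih1.
  - by apply/measurable_EFinP; apply: measurable_funD;
      apply/measurable_EFinP; [exact: measurable_int ihphi|exact: measurable_int igdphi].
  - have AE : {ae mu, forall x, `[a, b]%classic x ->
        (h1 x)%:E = (h x * phi.[x] + gK x * phi^`().[x])%:E}; last exact: AE.
    have h1ae' := @filterI _ _ (ae_filter_ringOfSetsType mu) _ _ h1ae eab.
    apply: filterS (@filterI _ _ (ae_filter_ringOfSetsType mu) _ _ hae h1ae')
      => x [hx [h1x [xa xb]]] /=; rewrite in_itv/= => /andP[ax xb'].
    have ax' : a < x by rewrite lt_neqAle ax andbT eq_sym; exact/eqP.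
    have xb'' : x < b by rewrite lt_neqAle xb' andbT; exact/eqP.
    have dk := is_deriv_onM (hx ax' xb'') (derive_is_deriv_on a b (is_derive_poly phi x)).
    by rewrite -(deriv_onE ab ax xb' (h1x ax' xb'')) (deriv_onE ab ax xb' dk) gKE.
have E3 : \int[mu]_(x in `[a, b]) (phi^`().[x] * gK x) =
    phi^`().[b] * f b - phi^`().[a] * f a - \int[mu]_(x in `[a, b]) (2 * f x).
  have LR := is_deriv_on_LRcontinuous dfg.
  apply: (@Rintegration_by_parts _ (fun x => phi^`().[x]) f (cst 2) gK) => //.
  - by apply: continuous_subspaceT; exact: cst_continuous.
  - split.
    + by move=> x _; exact: derivable_horner.
    + by apply: cvg_at_right_filter; exact: continuous_horner.
    + by apply: cvg_at_left_filter; exact: continuous_horner.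
  - move=> x _; have := is_derive_poly phi^`() x.
    by rewrite monic_quadratic_derivs// hornerC => dx; rewrite derive1E derive_val.
  - exact: continuous_subspaceT.
  - move=> x; rewrite in_itv/= => /andP[ax xb].
    have dx := is_deriv_on_derive ax xb (dfg _ (ltW ax) (ltW xb)).
    by rewrite derive1E derive_val gKE// ltW.
have cf : {within `[a, b], continuous f}.
  exact: derivable_oo_LRcontinuous_within (is_deriv_on_LRcontinuous dfg).
have jf : mu.-integrable `[a, b] (EFin \o f).
  by apply: continuous_compact_integrable => //; exact: segment_compact.
move: E2; rewrite -h1E ?(ltW ab)// RintegralD// => E2.
rewrite RintegralZl// in E3.
have E4 : \int[mu]_(x in `[a, b]) (phi^`().[x] * gK x) = \int[mu]_(x in `[a, b]) (gK x * phi^`().[x]).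
  by apply: eq_Rintegral => x _; rewrite mulrC.
rewrite /quad_rule /quad_error -/g E1; rewrite E4 in E3; rewrite E3 in E2.
lra.
Qed.

End error_functional.

Section extremal.
Context {R : realType}.
Notation mu := (@lebesgue_measure R).
Implicit Types (p q r : R).

Lemma conjugate_exponent p q : 1 < p -> p^-1 + q^-1 = 1 -> 1 < q /\ (q - 1) * p = q.
Proof.
move=> p1 pq; have p0 : p != 0 by rewrite gt_eqF// (lt_trans ltr01).
have q0 : q != 0.
  (* With the convention 0^-1 = 0, [q = 0] would force [p = 1]. *)
  apply/eqP => q0; move: pq; rewrite q0 invr0 addr0 => pV.
  by move: p1; rewrite -[p]invrK pV invr1 ltxx.
have E : (q - 1) * p = q.
  have : (p^-1 + q^-1) * (p * q) = p * q by rewrite pq mul1r.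
  have -> : (p^-1 + q^-1) * (p * q) = q + p by field; rewrite p0 q0.
  lra.
split=> //; have q_gt0 : 0 < q.
  rewrite -(pmulr_lgt0 q (_ : 0 < p - 1)) ?subr_gt0//.
  by have -> : q * (p - 1) = p; [move: E; lra|lra].
by rewrite -subr_gt0 -(pmulr_lgt0 (q - 1) (_ : 0 < p)) ?E//; lra.
Qed.

(** The integrand is positive beyond 1, so its primitive is strictly increasing there. Beyond 2 it
    is at least 1, so the value [J] is reached before [2 + J]. *)
Lemma exists_unique_upper_limit q J : 1 < q -> 0 < J ->
  exists! beta, 1 < beta /\ \int[mu]_(x in `[1, beta]) (x ^+ 2 - 1) `^ (q - 1) = J.
Proof.
move=> q1 J0; have q10 : 0 < q - 1 by rewrite subr_gt0.
pose f x : R := `|x ^+ 2 - 1| `^ (q - 1).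
have cf : continuous f.
  move=> x; apply: (@cvg_comp _ _ _ (fun y : R => y ^+ 2 - 1) (fun y : R => `|y| `^ (q - 1))).
    by apply: cvgB; [exact: exprn_continuous|exact: cvg_cst].
  exact: continuous_norm_powR.
have [G dG] := @continuous_primitive R f 0 (2^-1) (ltac:(by rewrite invr_gt0)) (fun x _ => cf x).
have h1 : 2^-1 < 1 :> R by lra.
have intE (x y : R) : 1 <= x -> x <= y -> \int[mu]_(t in `[x, y]) f t = G y - G x.
  move=> x1 xy; apply: Rintegral_derive => // t xt ty; apply: dG.
  by rewrite (lt_le_trans h1)// (le_trans x1).
have f_gt0 (x : R) : 1 < x -> 0 < f x.
  move=> x1; rewrite powR_gt0// normr_gt0 subr_eq0 gt_eqF// exprn_egt1//.
have G_incr (x y : R) : 1 <= x -> x < y -> G x < G y.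
  move=> x1 xy; rewrite -subr_gt0 -intE ?(ltW xy)//; apply: Rintegral_gt0 => //.
  - by move=> t _ _; exact: powR_ge0.
  - exists ((x + y) / 2); split; rewrite ?midf_lt//.
    by apply: f_gt0; apply: (le_lt_trans x1); rewrite midf_lt.
have GE beta : 1 < beta -> \int[mu]_(x in `[1, beta]) (x ^+ 2 - 1) `^ (q - 1) = G beta - G 1.
  move=> beta1; transitivity (\int[mu]_(t in `[1, beta]) f t); last by apply: intE => //; exact: ltW.
  apply: eq_Rintegral => x.
  rewrite inE/= in_itv/= => /andP[x1 _]; rewrite /f ger0_norm// subr_ge0 exprn_ege1//.
have cG (x y : R) : 1 <= x -> {within `[x, y], continuous G}.
  move=> x1; apply: continuous_in_subspaceT => t; rewrite inE/= in_itv/= => /andP[xt _].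
  by apply: (@is_derive_continuous _ _ _ (f t)); apply: dG; rewrite (lt_le_trans h1)// (le_trans x1).
have J2 : 2 <= 2 + J by rewrite lerDl ltW.
have GJ : G 1 + J <= G (2 + J).
  have dG2 (x : R) : x \in `]2, 2 + J[ -> is_derive x 1 G (f x).
    by rewrite in_itv/= => /andP[x2 _]; apply: dG; lra.
  have [c] := @MVT_segment R G f 2 (2 + J) J2 dG2 (cG _ _ (ler1n _ 2)).
  rewrite in_itv/= => /andP[c2 _] E.
  have fc : 1 <= f c.
    have : 1 `^ (q - 1) <= f c.
      apply: ge0_ler_powR; rewrite ?nnegrE//; first exact: ltW.
      by rewrite ger0_norm; nra.
    by rewrite powR1.
  have : J <= f c * (2 + J - 2) by rewrite [2 + J]addrC addrK ler_peMl// ltW.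
  rewrite -E; have := G_incr 1 2 (lexx 1); rewrite ltr1n => /(_ isT); lra.
have [beta] := @IVT R G 1 (2 + J) (G 1 + J) (ltac:(lra)) (cG _ _ (lexx 1)) (ltac:(
   rewrite (min_idPl _) ?(max_idPr _) ?GJ ?lerDl ?(ltW J0)//; lra)).
rewrite in_itv/= => /andP[beta1 betaJ] GB.
have beta1' : 1 < beta.
  rewrite lt_neqAle beta1 andbT; apply/eqP => b1; move: GB; rewrite -b1; lra.
exists beta; split; first by split => //; rewrite GE// GB; ring.
move=> beta' [beta'1]; rewrite GE// => GB'.
have GG : G beta = G beta' by rewrite GB; lra.
have [bb|bb|//] := ltgtP beta beta'.
- by have := G_incr _ _ beta1 bb; rewrite GG ltxx.
- by have := G_incr _ _ (ltW beta'1) bb; rewrite GG ltxx.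
Qed.

Lemma Rintegral_beta_gt0 q : 1 < q -> 0 < \int[mu]_(s in `[0, 1]) (1 - s ^+ 2) `^ (q - 1).
Proof.
move=> q1; have q10 : 0 < q - 1 by rewrite subr_gt0.
have -> : \int[mu]_(s in `[0, 1]) (1 - s ^+ 2) `^ (q - 1) = \int[mu]_(s in `[0, 1]) `|1 - s ^+ 2| `^ (q - 1).
  apply: eq_Rintegral => s; rewrite inE/= in_itv/= => /andP[s0 s1].
  by rewrite ger0_norm// subr_ge0 expr_le1.
apply: Rintegral_gt0 => //.
- move=> x; apply: (@cvg_comp _ _ _ (fun y : R => 1 - y ^+ 2) (fun y : R => `|y| `^ (q - 1))).
    by apply: cvgB; [exact: cvg_cst|exact: exprn_continuous].
  exact: continuous_norm_powR.
- exists 2^-1; split; [by rewrite invr_gt0|lra|].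
  by rewrite powR_gt0// normr_gt0 gt_eqF//; lra.
Qed.

Variables a b : R.
Hypothesis ab : a < b.

Lemma LpNorm_on_continuous r (psi : R -> R) : 0 < r -> continuous psi ->
  LpNorm_on a b r psi = ((\int[mu]_(x in `[a, b]) `|psi x| `^ r) `^ r^-1)%:E.
Proof.
move=> r0 cpsi; rewrite /LpNorm_on unlock /Lnorm/= -poweR_EFin; congr (_ `^ _)%E.
have cr : continuous (fun x => `|psi x| `^ r).
  move=> x; apply: (@cvg_comp _ _ _ psi (fun y : R => `|y| `^ r)); first exact: cpsi.
  exact: continuous_norm_powR.
rewrite /Rintegral fineK; last first.
  by apply: integrable_fin_num => //; exact: continuous_integrable_segment.
rewrite [RHS]integral_mkcond; apply: eq_integral => x _.
rewrite /= !patchE; case: ifP => // _.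
by rewrite normr0 powR0// gt_eqF.
Qed.

Lemma Lp_on_continuous r (psi : R -> R) : 0 < r -> continuous psi -> Lp_on a b r psi.
Proof.
move=> r0 cpsi; rewrite /Lp_on; apply/andP; split; rewrite inE/=.
  apply: (measurable_restrictT psi (measurable_itv `[a, b])).1.
  by apply: measurable_funTS; exact: continuous_measurable_fun.
have := LpNorm_on_continuous r0 cpsi; rewrite /finite_norm /LpNorm_on => ->.
exact: ltry.
Qed.

Definition power_integral q (phi : {poly R}) : R := \int[mu]_(x in `[a, b]) `|phi.[x]| `^ q.

Lemma continuous_norm_powR_poly q (phi : {poly R}) : 0 < q -> continuous (fun x => `|phi.[x]| `^ q).
Proof.
move=> q0 x; apply: (@cvg_comp _ _ _ (horner phi) (fun y : R => `|y| `^ q)).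
  exact: continuous_horner.
exact: continuous_norm_powR.
Qed.

Lemma continuous_sgpowR_poly q (phi : {poly R}) : 0 < q -> continuous (fun x => sgpowR q phi.[x]).
Proof.
move=> q0 x; apply: (@cvg_comp _ _ _ (horner phi) (sgpowR q)).
  exact: continuous_horner.
exact: continuous_sgpowR.
Qed.

Lemma quad_error_le p q (phi : {poly R}) (f : R -> R) : 1 < p -> p^-1 + q^-1 = 1 ->
  admissible a b p f ->
  ((`|quad_error a b phi f|)%:E <= LpNorm_on a b p (deriv_on a b (deriv_on a b f)) *
     (2^-1 * power_integral q phi `^ q^-1)%:E)%E.
Proof.
move=> p1 pq [_ _ Lpf]; have [q1 _] := conjugate_exponent p1 pq.
have p0 : 0 < p by lra. have q0 : 0 < q by lra.
set h := deriv_on a b (deriv_on a b f) in Lpf *.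
have mh := Lp_on_measurable Lpf.
have mphi : measurable_fun `[a, b] (horner phi).
  by apply: measurable_funTS; apply: continuous_measurable_fun; exact: continuous_horner.
have H := @hoelder _ _ _ mu (h \_ `[a, b]) (horner phi \_ `[a, b]) p q
  ((measurable_restrictT h (measurable_itv `[a, b])).1 mh)
  ((measurable_restrictT (horner phi) (measurable_itv `[a, b])).1 mphi) p0 q0 pq.
have Nq := @LpNorm_on_continuous q (horner phi) q0 (@continuous_horner _ phi).
rewrite /LpNorm_on in Nq; rewrite Nq in H.
rewrite EFinM muleCA /quad_error normrM EFinM gtr0_norm ?invr_gt0//.
rewrite lee_pmul2l ?lte_fin ?invr_gt0//.
apply: le_trans H; rewrite Lnorm1.
have -> : (\int[mu]_x `|(EFin \o (h \_ `[a, b] \* horner phi \_ `[a, b])%R) x| =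
    \int[mu]_(x in `[a, b]) `|(h x * phi.[x])%:E|)%E.
  rewrite [RHS]integral_mkcond; apply: eq_integral => x _ /=.
  by rewrite !patchE; case: ifP => _ //; rewrite mulr0 normr0.
(* [Rintegral] reads an infinite integral as 0, so this inequality holds in every case. *)
apply: (@le_trans _ _ `|\int[mu]_(x in `[a, b]) (h x * phi.[x])%:E|%E).
  rewrite /Rintegral; case: (\int[mu]_(x in `[a, b]) (h x * phi.[x])%:E)%E => [r||] //=.
    by rewrite normr0 leey.
  by rewrite normr0 leey.
apply: le_abse_integral => //.
by apply/measurable_EFinP; exact: measurable_funM.
Qed.

(* The equality case of Hoelder: f'' is proportional to [sgpowR (q - 1) phi]. *)
Lemma exists_extremal p q (phi : {poly R}) : 1 < p -> p^-1 + q^-1 = 1 ->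
  0 < power_integral q phi ->
  exists f, [/\ admissible a b p f,
    LpNorm_on a b p (deriv_on a b (deriv_on a b f)) = 1%E &
    quad_error a b phi f = 2^-1 * power_integral q phi `^ q^-1].
Proof.
move=> p1 pq; have [q1 qp] := conjugate_exponent p1 pq.
have p0 : 0 < p by lra. have q0 : 0 < q by lra. have q10 : 0 < q - 1 by lra.
set I := power_integral q phi => I0.
(* Since (q - 1) p = q, the integral of |psi|^p is s^p I, which this choice makes 1; the error is
   then half of s I = I^(1/q). *)
pose s := (I `^ p^-1)^-1; have s0 : 0 < s by rewrite invr_gt0 powR_gt0.
pose psi x := s * sgpowR (q - 1) phi.[x].
have csg := @continuous_sgpowR_poly (q - 1) phi q10.
have cpsi : continuous psi by move=> x; apply: cvgMr; exact: csg.
(* Each primitive loses a margin on the left; starting from [a - 2] keeps both differentiable on all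
   of [a, b]. *)
have [G1 dG1] := @continuous_primitive R psi (a - 2) (a - 1) (ltac:(lra)) (fun x _ => cpsi x).
have [G2 dG2] := @continuous_primitive R G1 (a - 1) (a - 2^-1) (ltac:(lra))
   (fun x hx => is_derive_continuous (dG1 x hx)).
have d1 x : a <= x -> x <= b -> is_deriv_on a b G2 x (G1 x).
  by move=> ax xb; apply: derive_is_deriv_on; apply: dG2; lra.
have D1 x : a <= x -> x <= b -> deriv_on a b G2 x = G1 x.
  by move=> ax xb; exact: deriv_onE (d1 x ax xb).
have d2 x : a <= x -> x <= b -> is_deriv_on a b (deriv_on a b G2) x (psi x).
  move=> ax xb; apply: (@is_deriv_on_eq _ _ _ G1) => //.
    by move=> y ay yb; rewrite D1.
  by apply: derive_is_deriv_on; apply: dG1; lra.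
have D2 x : a <= x -> x <= b -> deriv_on a b (deriv_on a b G2) x = psi x.
  by move=> ax xb; exact: deriv_onE (d2 x ax xb).
have patchD2 : deriv_on a b (deriv_on a b G2) \_ `[a, b] = psi \_ `[a, b].
  apply/funext => x; rewrite !patchE; case: ifPn => //.
  by rewrite inE/= in_itv/= => /andP[ax xb]; rewrite D2.
have QE : quad_error a b phi G2 = 2^-1 * (s *
        \int[mu]_(x in `[a, b]) (sgpowR (q - 1) phi.[x] * phi.[x])).
  rewrite /quad_error; congr (_ * _); rewrite -RintegralZl//; last first.
    apply: continuous_integrable_segment => x; apply: cvgM; first exact: csg.
    exact: continuous_horner.
  apply: eq_Rintegral => x; rewrite inE/= in_itv/= => /andP[ax xb].
  by rewrite D2// /psi mulrA.
exists G2; split.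
- split.
  + by move=> x; rewrite in_itv/= => /andP[ax xb]; exists (G1 x); exact: d1.
  + apply: (@abs_continuous_on_eq _ _ _ G1); first by move=> y ay yb; rewrite D1.
    have [|L L0 GL] := derive_lipschitz ab (continuous_subspaceT cpsi) (f := G1).
      by move=> x ax xb; apply: dG1; lra.
    exact: lipschitz_abs_continuous L0 GL.
  + by rewrite /Lp_on patchD2; exact: Lp_on_continuous.
- rewrite /LpNorm_on patchD2 -/(LpNorm_on a b p psi) LpNorm_on_continuous//.
  have -> : \int[mu]_(x in `[a, b]) `|psi x| `^ p = I^-1 * I.
    rewrite -RintegralZl//; last first.
      by apply: continuous_integrable_segment; exact: continuous_norm_powR_poly.
    apply: eq_Rintegral => x _; rewrite /psi normrM (gtr0_norm s0) norm_sgpowR//.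
    rewrite powRM ?powR_ge0 ?ltW// -powRrM qp; congr (_ * _).
    by rewrite /s -powRN -powRrM mulNr mulVf ?gt_eqF// powR_inv1// ltW.
  by rewrite mulVf ?gt_eqF// powR1.
- rewrite QE; congr (_ * _).
  have -> : \int[mu]_(x in `[a, b]) (sgpowR (q - 1) phi.[x] * phi.[x]) = I.
    by apply: eq_Rintegral => x _; rewrite mulrC mul_sgpowR.
  have In0 : I != 0 by rewrite gt_eqF.
  rewrite /s -powRN -{2}(powRr1 (ltW I0)) -powRD ?In0 ?implybT//.
  by congr (_ `^ _); lra.
Qed.

End extremal.

(** * The optimal quadratic *)

#[local] Opaque Rintegral powR.

(** Here [l] is the length, [g] is 1 - beta^-2 and [I] the minimal power integral. The power 2^(3 +
    1/q) collects the initial 1/2, the square of l/2, and 2 q + 1 = 2 (q + 1/2). *)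
Lemma optimal_constantE {R : realType} (q l g I : R) : 0 < q -> 0 < l -> 0 <= g ->
  (2 * q + 1) * I = l * ((l / 2) ^+ 2 * g) `^ q ->
  2^-1 * I `^ q^-1 = l `^ (2 + q^-1) * g / (2 `^ (3 + q^-1) * (q + 2^-1) `^ q^-1).
Proof.
move=> q0 l0 g0; set V := _ * g => IE.
have V0 : 0 <= V by rewrite mulr_ge0// exprn_ge0// divr_ge0//; exact: ltW.
have qh : 0 <= q + 2^-1 by rewrite addr_ge0//; exact: ltW.
have qh2 : 0 < 2 * q + 1 by rewrite addr_gt0// mulr_gt0.
have q_neq0 : q != 0 by rewrite gt_eqF.
have l_neq0 : l != 0 by rewrite gt_eqF.
have {IE} -> : I = l * V `^ q * (2 * q + 1)^-1.
  by rewrite -IE mulrC mulrA mulVf ?mul1r// gt_eqF.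
have [l0' qh'] := (ltW l0, ltW qh2).
rewrite powRM ?mulr_ge0 ?powR_ge0 ?invr_ge0// powRM ?powR_ge0//.
rewrite -powRrM mulfV// powRr1//.
have -> : (2 * q + 1)^-1 `^ q^-1 = ((2 * q + 1) `^ q^-1)^-1.
  by rewrite -[(2 * q + 1)^-1]powR_inv1// -powRrM mulN1r powRN.
have -> : (2 * q + 1) `^ q^-1 = 2 `^ q^-1 * (q + 2^-1) `^ q^-1.
  by rewrite -powRM//; congr (_ `^ _); field.
have -> : l `^ (2 + q^-1) = l ^+ 2 * l `^ q^-1.
  by rewrite powRD ?l_neq0 ?implybT// powR_mulrn.
have -> : 2 `^ (3 + q^-1) = 2 ^+ 3 * 2 `^ q^-1 :> R.
  by rewrite powRD ?pnatr_eq0 ?implybT// powR_mulrn.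
have h1 : (2 : R) `^ q^-1 != 0 by rewrite gt_eqF ?powR_gt0.
have h2 : (q + 2^-1) `^ q^-1 != 0 by rewrite gt_eqF ?powR_gt0 ?addr_gt0.
by rewrite /V; field; rewrite h1 h2.
Qed.

Section optimal_quadratic.
Context {R : realType}.
Notation mu := (@lebesgue_measure R).
Variables a b q beta alpha c : R.
Hypotheses (ab : a < b) (q1 : 1 < q) (beta1 : 1 < beta).
Hypothesis betaE : \int[mu]_(x in `[1, beta]) (x ^+ 2 - 1) `^ (q - 1) =
  \int[mu]_(s in `[0, 1]) (1 - s ^+ 2) `^ (q - 1).
Hypotheses (alpha_beta : alpha * beta = (b - a) / 2) (cE : c = (a + b) / 2).

Let phi0 : {poly R} := ('X - c%:P) ^+ 2 - (alpha ^+ 2)%:P.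

Let q0 : 0 < q. Proof. exact: lt_trans ltr01 q1. Qed.
Let q10 : 0 < q - 1. Proof. by rewrite subr_gt0. Qed.
Let beta0 : 0 < beta. Proof. exact: lt_trans ltr01 beta1. Qed.
Let alpha0 : 0 < alpha.
Proof. by rewrite -(pmulr_lgt0 alpha beta0) alpha_beta divr_gt0// subr_gt0. Qed.

Let phi0_expand : phi0 = 'X^2 + ((- (2 * c)) *: 'X + (c ^+ 2 - alpha ^+ 2)%:P).
Proof.
rewrite -mul_polyC polyCN polyCM polyCB !polyC_exp polyC_natr /phi0 polyC_exp; ring.
Qed.

Let phi0E x : phi0.[x] = (x - c) ^+ 2 - alpha ^+ 2.
Proof. by rewrite /phi0 !hornerE. Qed.

Let dphi0E x : phi0^`().[x] = 2 * (x - c).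
Proof.
by rewrite phi0_expand !derivD derivXn derivZ derivX derivC !hornerE /=; ring.
Qed.

Let S x := sgpowR (q - 1) phi0.[x].
Let cS : continuous S. Proof. exact: continuous_sgpowR_poly. Qed.

Let iS (m : R -> R) : continuous m -> mu.-integrable `[a, b] (EFin \o (fun x => S x * m x)).
Proof.
move=> cm; apply: continuous_integrable_segment => x.
by apply: cvgM; [exact: cS|exact: cm].
Qed.

Lemma optimal_quadratic_monic : monic_quadratic phi0.
Proof.
have s2 : (size ((- (2 * c)) *: 'X + (c ^+ 2 - alpha ^+ 2)%:P : {poly R})%R < 3)%N.
  rewrite (leq_ltn_trans (size_polyD _ _))// gtn_max.
  rewrite (leq_ltn_trans (size_scale_leq _ _)) ?size_polyX//=.
  by rewrite (leq_ltn_trans (size_polyC_leq1 _)).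
split; first by rewrite phi0_expand monicE lead_coefDl ?size_polyXn// lead_coefXn.
by rewrite phi0_expand size_polyDl ?size_polyXn.
Qed.

Let dpow (x : R) : is_derive x 1 (fun y : R => `|phi0.[y]| `^ q) (q * S x * (2 * (x - c))).
Proof.
have := @is_derive1_comp R (fun y : R => `|y| `^ q) (horner phi0) x _ _
  (is_derive_norm_powR phi0.[x] q1) (is_derive_poly phi0 x).
by rewrite dphi0E.
Qed.

Let phi0ab : phi0.[a] = phi0.[b].
Proof. by rewrite !phi0E cE; field. Qed.

(** Up to the factor 2 q the integrand is the derivative of |phi0|^q, and phi0 takes the same value
    at both ends. *)
Lemma Rintegral_sgpowR_optimal_lin : \int[mu]_(x in `[a, b]) (S x * (x - c)) = 0.
Proof.
have cm : continuous (fun x : R => x - c) by move=> x; apply: cvgB; [exact: cvg_id|exact: cvg_cst].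
have E : \int[mu]_(x in `[a, b]) (q * S x * (2 * (x - c))) = 0.
  have cd : continuous (fun x => q * S x * (2 * (x - c))).
    by move=> x; apply: cvgM; [apply: cvgMr; exact: cS|apply: cvgMr; exact: cm].
  by rewrite (Rintegral_derive (ltW ab) cd (fun x _ _ => dpow x)) phi0ab subrr.
have : 2 * q * \int[mu]_(x in `[a, b]) (S x * (x - c)) = 0.
  rewrite -RintegralZl//; last exact: iS.
  by rewrite -[RHS]E; apply: eq_Rintegral => x _; ring.
by move/eqP; rewrite mulf_eq0 mulf_eq0 pnatr_eq0 (gt_eqF q0) => /eqP.
Qed.

Let sg (u : R) := sgpowR (q - 1) (u ^+ 2 - 1).

Let csg : continuous sg.
Proof.
move=> x; apply: (@cvg_comp _ _ _ (fun y : R => y ^+ 2 - 1) (sgpowR (q - 1))).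
  by apply: cvgB; [exact: exprn_continuous|exact: cvg_cst].
exact: continuous_sgpowR.
Qed.

(* This and [Rintegral_sgpowR_optimal_lin] are the first order conditions for
   [phi0] to minimize the integral of [|phi|^q]; after [x = c + alpha t], this one
   is exactly the equation defining [beta]. *)
Lemma Rintegral_sgpowR_optimal : \int[mu]_(x in `[a, b]) S x = 0.
Proof.
have csg' (x : R) : - beta - 2 < x -> {for x, continuous sg} by move=> _; exact: csg.
have bb : - beta - 2 < - beta - 1 by lra.
have [T dT] := continuous_primitive bb csg'.
(* u^2 - 1 is negative on [0, 1[ and positive beyond 1; the choice of beta makes the two
   contributions cancel, so [T beta = T 0]. *)
have T01 : T 1 - T 0 = - \int[mu]_(s in `[0, 1]) (1 - s ^+ 2) `^ (q - 1).
  have dT01 (x : R) : 0 <= x -> x <= 1 -> is_derive x 1 T (sg x) by move=> x0 _; apply: dT; move: beta0; lra.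
  rewrite -(Rintegral_derive ler01 csg dT01).
  have -> : \int[mu]_(x in `[0, 1]) sg x = \int[mu]_(x in `[0, 1]) (-1 * sgpowR (q - 1) (1 - x ^+ 2)).
    by apply: eq_Rintegral => x _; rewrite /sg -[x ^+ 2 - 1]opprB sgpowRN mulN1r.
  rewrite RintegralZl//; last first.
    apply: continuous_integrable_segment => x.
    apply: (@cvg_comp _ _ _ (fun y : R => 1 - y ^+ 2) (sgpowR (q - 1))).
      by apply: cvgB; [exact: cvg_cst|exact: exprn_continuous].
    exact: continuous_sgpowR.
  rewrite mulN1r; congr (- _); apply: eq_Rintegral => x; rewrite inE/= in_itv/= => /andP[x0 x1].
  by rewrite sgpowRE// subr_ge0 expr_le1.
have T1b : T beta - T 1 = \int[mu]_(s in `[0, 1]) (1 - s ^+ 2) `^ (q - 1).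
  have dT1b (x : R) : 1 <= x -> x <= beta -> is_derive x 1 T (sg x).
    by move=> x1 _; apply: dT; move: beta0; lra.
  rewrite -betaE -(Rintegral_derive (ltW beta1) csg dT1b).
  apply: eq_Rintegral => x; rewrite inE/= in_itv/= => /andP[x1 _].
  by rewrite /sg sgpowRE// subr_ge0 exprn_ege1.
(* [sg] is even, so T y + T(-y) has zero derivative. *)
have Tsym : T beta + T (- beta) = T 0 + T 0.
  apply/eqP; rewrite -subr_eq0; apply/eqP.
  have dE (x : R) : 0 <= x -> x <= beta ->
      is_derive x 1 (fun y : R => T y + T (- y)) (cst 0 x : R).
    move=> x0 xb; have h1 : is_derive x 1 T (sg x) by apply: dT; move: beta0; lra.
    have h2 : is_derive (- x) 1 T (sg (- x)) by apply: dT; lra.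
    have dN : is_derive x 1 (-%R : R -> R) (-1) by exact: is_deriveN.
    by apply: (is_derive_eq (is_deriveD h1 (is_derive1_comp h2 dN))); rewrite /sg sqrrN mulrN1 subrr.
  have := Rintegral_derive (ltW beta0) (@cst_continuous _ _ 0) dE.
  rewrite oppr0 => <-; by rewrite Rintegral_cst ?mul0r//; exact: measurable_itv.
have T0 : T beta - T (- beta) = 0 by lra.
have an0 : alpha != 0 by rewrite gt_eqF.
(* One factor alpha comes from dx = alpha dt, the other from the homogeneity of the signed power, as
   phi0 = alpha^2 (t^2 - 1). *)
pose K := alpha * (alpha ^+ 2) `^ (q - 1).
have dK (x : R) : a <= x -> x <= b -> is_derive x 1 (fun x : R => K * T ((x - c) / alpha)) (S x).
  move=> ax xb.
  have dl : is_derive x 1 (fun y : R => (y - c) / alpha) (alpha^-1).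
    have -> : (fun y : R => (y - c) / alpha) = horner (alpha^-1 *: ('X - c%:P)).
      by apply/funext => y; rewrite !hornerE mulrC.
    by apply: (is_derive_eq (is_derive_poly _ x));
      rewrite derivZ derivB derivX derivC subr0 hornerZ hornerE mulr1.
  have dTx : is_derive ((x - c) / alpha) 1 T (sg ((x - c) / alpha)).
    apply: dT; rewrite ltr_pdivlMr//.
    have : (- beta - 1) * alpha = - ((b - a) / 2) - alpha by rewrite -alpha_beta; ring.
    by move=> ->; rewrite cE; move: alpha0; lra.
  suff -> : S x = K * (sg ((x - c) / alpha) * alpha^-1).
    have -> : (fun y : R => K * T ((y - c) / alpha)) =
        K *: (T \o (fun y : R => (y - c) / alpha)) by apply/funext.
    exact: (is_deriveZ K (@is_derive1_comp R T (fun y : R => (y - c) / alpha) x _ _ dTx dl)).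
  rewrite /K /S /sg phi0E.
  have -> : (x - c) ^+ 2 - alpha ^+ 2 = alpha ^+ 2 * (((x - c) / alpha) ^+ 2 - 1) by field.
  rewrite sgpowRM ?exprn_gt0//; move: (_ `^ _) (sgpowR _ _) => A B.
  by field.
rewrite (Rintegral_derive (ltW ab) cS dK).
have bc : b - c = beta * alpha by rewrite mulrC alpha_beta cE; field.
have ac : a - c = - beta * alpha by rewrite mulNr mulrC alpha_beta cE; field.
by rewrite bc ac !mulfK// -mulrBr T0 mulr0.
Qed.

(* Integrate the derivative of [(x - c) |phi0|^q]. *)
Lemma power_integral_optimal :
  (2 * q + 1) * power_integral a b q phi0 = (b - a) * phi0.[b] `^ q.
Proof.
have b_ge0 : 0 <= phi0.[b].
  rewrite phi0E; have -> : b - c = alpha * beta by rewrite alpha_beta cE; field.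
  have -> : (alpha * beta) ^+ 2 - alpha ^+ 2 = alpha ^+ 2 * (beta ^+ 2 - 1) by ring.
  have beta1' := ltW beta1; have alpha0' := ltW alpha0.
  by rewrite mulr_ge0 ?exprn_ge0// subr_ge0 exprn_ege1.
have cpow := @continuous_norm_powR_poly R q phi0 q0.
(* The product rule gives |phi0|^q + 2 q (x - c)^2 S; then (x - c)^2 = phi0 + alpha^2 and phi0 S =
   |phi0|^q. The term in S integrates to 0. *)
have d (x : R) : is_derive x 1 ((fun y : R => y - c) * (fun y : R => `|phi0.[y]| `^ q))
   ((2 * q + 1) * `|phi0.[x]| `^ q + 2 * q * alpha ^+ 2 * S x).
  have dl : is_derive x 1 (fun y : R => y - c) 1.
    have -> : (fun y : R => y - c) = horner ('X - c%:P) by apply/funext => y; rewrite !hornerE.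
    by apply: (is_derive_eq (is_derive_poly _ x)); rewrite derivB derivX derivC subr0 hornerE.
  apply: (is_derive_eq (is_deriveM dl (dpow x))); rewrite /GRing.scale/= mulr1.
  rewrite -(mul_sgpowR phi0.[x] q1) -/(S x) phi0E; ring.
have cd : continuous (fun x => (2 * q + 1) * `|phi0.[x]| `^ q + 2 * q * alpha ^+ 2 * S x).
  by move=> x; apply: cvgD; apply: cvgMr; [exact: cpow|exact: cS].
have := Rintegral_derive (ltW ab) cd (fun x _ _ => d x).
rewrite RintegralD; [|exact: measurable_itv| |]; last 2 first.
- by apply: (@continuous_integrable_segment R (fun x => (2 * q + 1) * `|phi0.[x]| `^ q))
    => x; apply: cvgMr; exact: cpow.
- by apply: (@continuous_integrable_segment R (fun x => 2 * q * alpha ^+ 2 * S x))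
    => x; apply: cvgMr; exact: cS.
rewrite !RintegralZl; [|exact: measurable_itv|exact: continuous_integrable_segment
  |exact: measurable_itv|exact: continuous_integrable_segment].
rewrite Rintegral_sgpowR_optimal mulr0 addr0 /power_integral => ->.
rewrite !fctE phi0ab -mulrBl ger0_norm//; congr (_ * _); ring.
Qed.

Lemma optimal_quadratic_end : phi0.[b] = ((b - a) / 2) ^+ 2 * (1 - beta ^- 2).
Proof.
rewrite phi0E; have -> : b - c = alpha * beta by rewrite alpha_beta cE; field.
by rewrite -alpha_beta; field; rewrite gt_eqF.
Qed.

Lemma power_integral_optimal_lt phi : monic_quadratic phi -> phi <> phi0 ->
  power_integral a b q phi0 < power_integral a b q phi.
Proof.
move=> /monic_quadraticP[u [v phiE]] phi_neq.
have [u0 [v0 phi0E']] := monic_quadraticP optimal_quadratic_monic.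
pose m := u - u0; pose n := v - v0 + m * c.
have phix x : phi.[x] = x ^+ 2 + (u * x + v) by rewrite phiE !hornerE.
have phi0x x : phi0.[x] = x ^+ 2 + (u0 * x + v0) by rewrite phi0E' !hornerE.
have diffE x : phi.[x] - phi0.[x] = m * (x - c) + n.
  by rewrite phix phi0x /n /m; ring.
(* The gap above the tangent. Its linear term integrates to 0, since [phi - phi0] has degree at most
   one and S is orthogonal to such polynomials. *)
pose D x := `|phi.[x]| `^ q - (`|phi0.[x]| `^ q + q * S x * (phi.[x] - phi0.[x])).
have D_gt0 x : phi.[x] != phi0.[x] -> 0 < D x.
  by move=> neq; rewrite subr_gt0; exact: norm_powR_tangent.
have D_ge0 x : 0 <= D x.
  have [eq|neq] := eqVneq phi.[x] phi0.[x]; last exact/ltW/D_gt0.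
  by rewrite /D eq subrr mulr0 addr0 subrr.
have cpow := @continuous_norm_powR_poly R q phi q0.
have cpow0 := @continuous_norm_powR_poly R q phi0 q0.
have cm : continuous (fun x : R => x - c) by move=> x; apply: cvgB; [exact: cvg_id|exact: cvg_cst].
pose L x := q * m * (S x * (x - c)) + q * n * S x.
have c1 : continuous (fun x => q * m * (S x * (x - c))).
  by move=> x; apply: cvgMr; apply: cvgM; [exact: cS|exact: cm].
have c2 : continuous (fun x => q * n * S x) by move=> x; apply: cvgMr; exact: cS.
have cL : continuous L by move=> x; apply: cvgD; [exact: c1|exact: c2].
have LE x : q * S x * (phi.[x] - phi0.[x]) = L x by rewrite diffE /L; ring.
have L0 : \int[mu]_(x in `[a, b]) L x = 0.
  rewrite RintegralD; [|exact: measurable_itv|exact: continuous_integrable_segment..].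
  rewrite !RintegralZl; [|exact: measurable_itv|exact: continuous_integrable_segment
  |exact: measurable_itv|exact: iS].
  by rewrite Rintegral_sgpowR_optimal_lin Rintegral_sgpowR_optimal !mulr0 addr0.
have cD0 : continuous (fun x => `|phi0.[x]| `^ q + L x).
  by move=> x; apply: cvgD; [exact: cpow0|exact: cL].
have DE : D = (fun x => `|phi.[x]| `^ q - (`|phi0.[x]| `^ q + L x)).
  by apply/funext => x; rewrite /D LE.
have : 0 < \int[mu]_(x in `[a, b]) D x.
  apply: Rintegral_gt0; first exact: ab.
  - by rewrite DE => x; apply: cvgB; [exact: cpow|exact: cD0].
  - by move=> x _ _; exact: D_ge0.
  (* A point where [phi] and [phi0] differ: the midpoint [c] if [n] is nonzero; otherwise the
     difference [m * (x - c)] vanishes only at [c], and any other interior point serves. *)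
  have [n0|n0] := eqVneq n 0; last first.
    exists c; split; rewrite ?cE ?midf_lt//.
    by apply: D_gt0; rewrite -subr_eq0 diffE cE subrr mulr0 add0r.
  have [m0|m0] := eqVneq m 0.
    exfalso; apply: phi_neq; apply/eqP; rewrite phiE phi0E'.
    move: m0 n0; rewrite /n /m => /eqP; rewrite subr_eq0 => /eqP ->.
    by rewrite subrr mul0r addr0 => /eqP; rewrite subr_eq0 => /eqP ->.
  exists ((a + c) / 2); split; rewrite ?cE; [by move: ab; lra|by move: ab; lra|].
  apply: D_gt0; rewrite -subr_eq0 diffE n0 addr0 mulf_neq0 ?m0// subr_eq0.
  by rewrite lt_eqF// cE; move: ab; lra.
rewrite DE RintegralB; [|exact: measurable_itv|exact: continuous_integrable_segment..].
rewrite RintegralD; [|exact: measurable_itv|exact: continuous_integrable_segment..].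
by rewrite L0 addr0 subr_gt0.
Qed.

Lemma power_integral_optimal_root : 2^-1 * power_integral a b q phi0 `^ q^-1 =
  (b - a) `^ (2 + q^-1) * (1 - beta ^- 2) / (2 `^ (3 + q^-1) * (q + 2^-1) `^ q^-1).
Proof.
have ba : 0 < b - a by rewrite subr_gt0.
have g0 : 0 <= 1 - beta ^- 2.
  by rewrite subr_ge0 invf_le1 ?exprn_gt0 ?beta0// exprn_ege1 ?(ltW beta1).
apply: optimal_constantE => //.
by rewrite power_integral_optimal optimal_quadratic_end.
Qed.

End optimal_quadratic.

Theorem theorem2p1 (R : realType) (a b p q : R) (hab : a < b) (hp : 1 < p)
    (hpq : p^-1 + q^-1 = 1) :
  [/\ 2^-1 * Beta_fun q 2^-1 = 2 `^ (2 * q - 2) * Beta_fun q q,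
      exists! beta : R, 1 < beta /\
        \int[lebesgue_measure]_(x in `[1, beta]) ((x ^+ 2 - 1) `^ (q - 1))
          = 2^-1 * Beta_fun q 2^-1
    & forall (beta alpha c : R) (phi0 : {poly R}) (C : R),
        1 < beta ->
        \int[lebesgue_measure]_(x in `[1, beta]) ((x ^+ 2 - 1) `^ (q - 1))
          = 2^-1 * Beta_fun q 2^-1 ->
        alpha * beta = (b - a) / 2 ->
        c = (a + b) / 2 ->
        phi0 = ('X - c%:P) ^+ 2 - (alpha ^+ 2)%:P ->
        C = (b - a) `^ (2 + q^-1) * (1 - beta ^- 2)
              / (2 `^ (3 + q^-1) * (q + 2^-1) `^ q^-1) ->
        [/\ (forall (phi : {poly R}) (f : R -> R),
               monic_quadratic phi -> admissible a b p f ->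
               \int[lebesgue_measure]_(x in `[a, b]) f x
                 = quad_rule a b phi f + quad_error a b phi f),
            (monic_quadratic phi0 /\
             forall phi : {poly R}, monic_quadratic phi -> phi <> phi0 ->
               (worst_error a b p phi0 < worst_error a b p phi)%E),
            (forall f : R -> R, admissible a b p f ->
               \int[lebesgue_measure]_(x in `[a, b]) f x
                 = (b - a) / 2 * (f a + f b)
                   + (b - a) ^+ 2 / 8 * (1 - beta ^- 2)
                     * (deriv_on a b f a - deriv_on a b f b)
                   + quad_error a b phi0 f),
            (forall f : R -> R, admissible a b p f ->
               ((`|quad_error a b phi0 f|)%:E
                 <= LpNorm_on a b p (deriv_on a b (deriv_on a b f)) * C%:E)%E)
          & (forall K : R,
               (forall f : R -> R, admissible a b p f ->
                  ((`|quad_error a b phi0 f|)%:E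
                    <= LpNorm_on a b p (deriv_on a b (deriv_on a b f)) * K%:E)%E) ->
               C <= K)]].
Proof.
have [q1 _] := conjugate_exponent hp hpq.
rewrite (Beta_fun_half q1) (Beta_fun_diag q1); split.
- by [].
- exact: exists_unique_upper_limit q1 (Rintegral_beta_gt0 q1).
move=> beta alpha c phi0 C beta1 betaE alpha_beta cE phi0E CE.
have mphi0 : monic_quadratic phi0 by rewrite phi0E; exact: optimal_quadratic_monic.
have q0 : 0 < q := lt_trans ltr01 q1.
have beta0 : 0 < beta := lt_trans ltr01 beta1.
have Croot : C = 2^-1 * power_integral a b q phi0 `^ q^-1.
  by rewrite CE phi0E (power_integral_optimal_root hab q1 beta1 betaE alpha_beta cE).
have g0 : 0 < 1 - beta ^- 2.
  by rewrite subr_gt0 invf_lt1 ?exprn_gt0// exprn_egt1.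
have end_b := optimal_quadratic_end beta1 alpha_beta cE.
rewrite -phi0E in end_b.
have I0 : 0 < power_integral a b q phi0.
  have := power_integral_optimal hab q1 beta1 betaE alpha_beta cE.
  rewrite -phi0E => E.
  have q2 : 0 < 2 * q + 1 by rewrite addr_gt0 ?mulr_gt0.
  rewrite -(pmulr_rgt0 _ q2) E; apply: mulr_gt0; first by rewrite subr_gt0.
  apply: powR_gt0; rewrite end_b; apply: mulr_gt0; last exact: g0.
  by rewrite exprn_gt0 ?divr_gt0 ?subr_gt0.
have bound f : admissible a b p f ->
    ((`|quad_error a b phi0 f|)%:E
       <= LpNorm_on a b p (deriv_on a b (deriv_on a b f)) * C%:E)%E.
  by move=> adm; rewrite Croot; exact: quad_error_le.
have C0 : 0 <= C by rewrite Croot mulr_ge0 ?invr_ge0// powR_ge0.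
split.
- by move=> phi f mphi adm; exact: quadrature_formula mphi adm.
- split=> // phi mphi phi_neq.
  have Ilt := power_integral_optimal_lt hab q1 beta1 betaE alpha_beta cE mphi.
  rewrite -phi0E in Ilt; have {}Ilt := Ilt phi_neq.
  (* [C] separates the two suprema: it bounds every error of [phi0], while the extremal function of
     [phi] exceeds it. *)
  apply: (@le_lt_trans _ _ C%:E).
    apply: ge_ereal_sup => _ [f [adm f1] <-]; apply: le_trans (bound f adm) _.
    by rewrite -[leRHS]mul1e lee_wpmul2r.
  have [f [adm f1 Ef]] := exists_extremal hab hp hpq (lt_trans I0 Ilt).
  apply: (@lt_le_trans _ _ (`|quad_error a b phi f|)%:E).
    rewrite lte_fin Ef ger0_norm; last by rewrite mulr_ge0 ?invr_ge0// powR_ge0.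
    have I1 := ltW (lt_trans I0 Ilt); have I0' := ltW I0.
    have h2 : 0 < 2^-1 :> R by rewrite invr_gt0.
    have q0V : 0 < q^-1 by rewrite invr_gt0.
    rewrite Croot (ltr_pM2l h2); exact: (gt0_ltr_powR q0V I0' I1 Ilt).
  by apply: ereal_sup_ubound; exists f; [split; [exact: adm|rewrite f1]|].
- move=> f adm; rewrite (quadrature_formula hab mphi0 adm); congr (_ + _).
  have end_a : phi0.[a] = phi0.[b] by rewrite phi0E !hornerE cE; field.
  have dE x : phi0^`().[x] = 2 * (x - c).
    by rewrite phi0E expr2 derivB derivM derivB derivX !derivC !hornerE; ring.
  rewrite /quad_rule end_a end_b !dE cE.
  field; by rewrite gt_eqF.
- exact: bound.
(* The extremal function of [phi0] has second derivative of norm 1 and error exactly [C]. *)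
- move=> K boundK; have [f [adm f1 Ef]] := exists_extremal hab hp hpq I0.
  have := boundK f adm; rewrite f1 mul1e lee_fin Ef ger0_norm -?Croot//.
Qed.
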